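(* Let $\Sigma$ be given in a special coordinate basis (SCB) as in the context, strongly detectable (so $n_c=0$ and $A_a$ is Hurwitz), with $F_{dd}$ having the lower-block-triangular structure described in the context. Assume the unknown input satisfies $|u_{d,i}(t)|\le\Delta_{d,i}$ for all $t\ge0$ and $i=1,\dots,m_d$, for known constants $\Delta_{d,i}\ge 0$. Let $L_b$ be such that $A_b-L_bC_b$ is Hurwitz, and let $\hat x_a,\hat x_b$ be generated by $\dot{\hat x}_a=A_a\hat x_a+H_{ab}y_b+H_{ad}y_d+B_{0a}y_0$, $\dot{\hat x}_b=A_b\hat x_b+H_{bd}y_d+B_{0b}y_0+L_b(y_b-C_b\hat x_b)$. Consider the observer $\dot{\hat x}_d=(A_d^\star+B_dF_{dd})\hat x_d+B_d(F_{da}\hat x_a+F_{db}\hat x_b)+B_{0d}y_0+H_{dd}y_d+l_d(e_{d,y})$, where $e_{d,y}=y_d-C_d\hat x_d$, whose $i$-th component is $e_{d,w_i}:=x_{d,w_i}-\hat x_{d,w_i}$ with $w_i=\sum_{j=1}^{i-1}q_j+1$, and $l_d:\mathbb R^{m_d}\to\mathbb R^{n_d}$ has component with index $w_i+j-1$ equal to $\kappa_{i,j}\lfloor e_{d,w_i}\rceil^{(q_i-j)/q_i}$ for $i=1,\dots,m_d$, $j=1,\dots,q_i$, with gains $\kappa_{i,j}>0$. Then there exist sufficiently large gains $\kappa_{i,j}>0$ such that for every initial condition of the system and of the observers there is a finite time $T_f$ with $x_d(t)-\hat x_d(t)=0$ for all $t\ge T_f$.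
   Context: Notation: for an integer $k\ge 1$, $J_k\in\mathbb R^{k\times k}$ is the matrix with ones on the first superdiagonal and zeros elsewhere, $B_k=[0\ \cdots\ 0\ 1]^\top\in\mathbb R^{k}$, $C_k=[1\ 0\ \cdots\ 0]\in\mathbb R^{1\times k}$, and $\mathrm{diag}(\cdot)$ denotes a (block) diagonal matrix. For $z\in\mathbb R$, $\lfloor z\rceil^a=\mathrm{sign}(z)|z|^a$ and $\lfloor z\rceil^0=\mathrm{sign}(z)$; solutions of differential equations with discontinuous right-hand side are understood in the sense of Filippov. Consider the linear time-invariant system $\Sigma$: $\dot x=Ax+Bu$, $y=Cx+Du$, with $x\in\mathbb R^n$, $u\in\mathbb R^m$, $y\in\mathbb R^p$, $\operatorname{rank}D=m_0$, and with $[B^\top\ D^\top]$ and $[C\ D]$ of full rank. Special coordinate basis (SCB): $\Sigma$ is in SCB if its state, input and output are partitioned as $x=(x_a,x_b,x_c,x_d)$ with $x_a\in\mathbb R^{n_a},x_b\in\mathbb R^{n_b},x_c\in\mathbb R^{n_c},x_d\in\mathbb R^{n_d}$, $u=(u_0,u_d,u_c)$ with $u_0\in\mathbb R^{m_0},u_d\in\mathbb R^{m_d},u_c\in\mathbb R^{m_c}$, $y=(y_0,y_d,y_b)$ with $y_0\in\mathbb R^{m_0},y_d\in\mathbb R^{m_d},y_b\in\mathbb R^{p_b}$, such that $y_0=C_{0a}x_a+C_{0b}x_b+C_{0c}x_c+C_{0d}x_d+u_0$, $y_d=C_dx_d$, $y_b=C_bx_b$, $\dot x_a=A_ax_a+H_{ab}C_bx_b+H_{ad}C_dx_d+B_{0a}y_0$,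 $\dot x_b=A_bx_b+H_{bd}C_dx_d+B_{0b}y_0$, $\dot x_c=B_cF_{ca}x_a+H_{cb}C_bx_b+A_cx_c+H_{cd}C_dx_d+B_{0c}y_0+B_cu_c$, $\dot x_d=B_dF_{da}x_a+B_dF_{db}x_b+B_dF_{dc}x_c+A_dx_d+B_{0d}y_0+B_du_d$, with constant real matrices of appropriate dimensions, where $A_b=\mathrm{diag}(J_{l_1},\dots,J_{l_{p_b}})+H_{bb}C_b$, $C_b=\mathrm{diag}(C_{l_1},\dots,C_{l_{p_b}})$ for positive integers $l_i$ with $\sum_i l_i=n_b$; $B_d=\mathrm{diag}(B_{q_1},\dots,B_{q_{m_d}})$, $C_d=\mathrm{diag}(C_{q_1},\dots,C_{q_{m_d}})$ for integers $q_1\ge q_2\ge\dots\ge q_{m_d}\ge 1$ with $\sum_i q_i=n_d$; and $A_d=A_d^\star+B_dF_{dd}+H_{dd}C_d$ with $A_d^\star=\mathrm{diag}(J_{q_1},\dots,J_{q_{m_d}})$, $F_{dd}\in\mathbb R^{m_d\times n_d}$, $H_{dd}\in\mathbb R^{n_d\times m_d}$. Structure of $F_{dd}$: partition the columns of $F_{dd}$ into consecutive blocks of widths $q_1,\dots,q_{m_d}$ and denote by $f_{i,j,k}$ the entry of row $i$ in the $k$-th column of block $j$; the structure requires $f_{i,j,k}=0$ whenever $j\ge i$ or $k=1$ (such an SCB always exists). $\Sigma$ is strongly detectable if $y(t)=0$ for all $t\ge0$ implies $x(t)\to0$ as $t\to\infty$, for all inputs and initial states; for a system in SCB this is equivalent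 to $n_c=0$ and $A_a$ Hurwitz (so the blocks $x_c,u_c$ are absent). Also, $(A_b,C_b)$ is observable in any SCB. *)

(* Defs.v *)
From HB Require Import structures.
From mathcomp Require Import all_boot all_order all_algebra.
From mathcomp Require Import all_classical all_reals all_analysis.
From mathcomp Require Import complex.
Set Implicit Arguments. Unset Strict Implicit. Unset Printing Implicit Defensive.
Import Order.TTheory GRing.Theory Num.Theory.
Local Open Scope ring_scope.
Local Open Scope classical_set_scope.

Definition hurwitz (R : realType) (n : nat) (A : 'M[R]_n) : Prop :=
  forall z : R[i], root (map_poly (fun x : R => Complex x 0) (char_poly A)) z ->
    complex.Re z < 0.

(* Block structure given by block sizes q : 'I_m -> nat (blocks laid out
   consecutively).  [wst q i] is the (0-based) index of the first entry of
   block i, i.e. w_i - 1 in the paper's notation.                         *)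
Definition wst (m : nat) (q : 'I_m -> nat) (i : 'I_m) : nat :=
  (\sum_(j < m | (j < i)%N) q j)%N.
Definition in_blk (m : nat) (q : 'I_m -> nat) (i : 'I_m) (r : nat) : bool :=
  (wst q i <= r < wst q i + q i)%N.

Definition Jdiag (R : realType) (m : nat) (q : 'I_m -> nat) (n : nat) : 'M[R]_n :=
  \matrix_(r < n, s < n)
    (((s : nat) == r.+1) && [exists i, in_blk q i r && in_blk q i s])%:R.
Definition Bdiag (R : realType) (m : nat) (q : 'I_m -> nat) (n : nat) : 'M[R]_(n, m) :=
  \matrix_(r < n, i < m) ((r : nat) == (wst q i + q i).-1)%:R.
Definition Cdiag (R : realType) (m : nat) (q : 'I_m -> nat) (n : nat) : 'M[R]_(m, n) :=
  \matrix_(i < m, r < n) ((r : nat) == wst q i)%:R.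

(* A strongly detectable system in SCB (x_c, u_c absent since n_c = 0).   *)
Record SCB (R : realType) := mkSCB {
  na : nat; nb : nat; nd : nat; m0 : nat; md : nat; pb : nat;
  lb : 'I_pb -> nat;
  qd : 'I_md -> nat;
  C0a : 'M[R]_(m0, na); C0b : 'M[R]_(m0, nb); C0d : 'M[R]_(m0, nd);
  Aa : 'M[R]_na; Hab : 'M[R]_(na, pb); Had : 'M[R]_(na, md); B0a : 'M[R]_(na, m0);
  Hbb : 'M[R]_(nb, pb); Hbd : 'M[R]_(nb, md); B0b : 'M[R]_(nb, m0);
  Fda : 'M[R]_(md, na); Fdb : 'M[R]_(md, nb); Fdd : 'M[R]_(md, nd);
  Hdd : 'M[R]_(nd, md); B0d : 'M[R]_(nd, m0)
}.

Section SCBmats.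
Context {R : realType} (S : SCB R).
Definition Cb : 'M[R]_(pb S, nb S) := Cdiag R (@lb R S) (nb S).
Definition Ab : 'M[R]_(nb S) := Jdiag R (@lb R S) (nb S) + Hbb S *m Cb.
Definition Bd : 'M[R]_(nd S, md S) := Bdiag R (@qd R S) (nd S).
Definition Cd : 'M[R]_(md S, nd S) := Cdiag R (@qd R S) (nd S).
Definition Adstar : 'M[R]_(nd S) := Jdiag R (@qd R S) (nd S).
Definition Ad : 'M[R]_(nd S) := Adstar + Bd *m Fdd S + Hdd S *m Cd.
End SCBmats.

Definition scb_wf (R : realType) (S : SCB R) : Prop :=
  [/\ (\sum_(i < pb S) @lb R S i)%N = nb S /\ (forall i, (0 < @lb R S i)%N),
      (\sum_(i < md S) @qd R S i)%N = nd S, (forall i, (0 < @qd R S i)%N),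
      (forall i j : 'I_(md S), (i <= j)%N -> (@qd R S j <= @qd R S i)%N) &
      (forall (i j : 'I_(md S)) (r : 'I_(nd S)),
          in_blk (@qd R S) j r -> ((i <= j)%N || ((r : nat) == wst (@qd R S) j)) ->
          Fdd S i r = 0)].

Definition sigpow (R : realType) (z a : R) : R :=
  if a == 0 then Num.sg z else Num.sg z * (`|z| `^ a).

(* The injection l_d : R^{m_d} -> R^{n_d}; the component of (0-based) index
   r = wst i + (j-1) (j = 1..q_i) is kappa_{i,j} sigpow (e_i) ((q_i - j)/q_i).
   Gains are stored as kappa i (j-1). *)
Definition ld (R : realType) (S : SCB R) (kappa : 'I_(md S) -> nat -> R)
    (e : 'cV[R]_(md S)) : 'cV[R]_(nd S) :=
  \col_(r < nd S) \sum_(i < md S)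
     (if in_blk (@qd R S) i r then
        kappa i (r - wst (@qd R S) i)%N *
        sigpow (e i 0) ((@qd R S i - (r - wst (@qd R S) i).+1)%N%:R / (@qd R S i)%:R)
      else 0).

(* Closed-loop state z = (x_a, x_b, x_d, xh_a, xh_b, xh_d). *)
Definition Ntot (R : realType) (S : SCB R) : nat :=
  ((na S + nb S + nd S) + (na S + nb S + nd S))%N.

Section ClosedLoop.
Context {R : realType} (S : SCB R).
Implicit Types z : 'cV[R]_((na S + nb S + nd S) + (na S + nb S + nd S)).
Definition get_xa z : 'cV[R]_(na S) := usubmx (usubmx (usubmx z)).
Definition get_xb z : 'cV[R]_(nb S) := dsubmx (usubmx (usubmx z)).
Definition get_xd z : 'cV[R]_(nd S) := dsubmx (usubmx z).
Definition get_ha z : 'cV[R]_(na S) := usubmx (usubmx (dsubmx z)).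
Definition get_hb z : 'cV[R]_(nb S) := dsubmx (usubmx (dsubmx z)).
Definition get_hd z : 'cV[R]_(nd S) := dsubmx (dsubmx z).

Definition closed_loop (Lb : 'M[R]_(nb S, pb S)) (kappa : 'I_(md S) -> nat -> R)
    (u0 : R -> 'cV[R]_(m0 S)) (ud : R -> 'cV[R]_(md S)) (t : R) z
    : 'cV[R]_((na S + nb S + nd S) + (na S + nb S + nd S)) :=
  let xa := get_xa z in let xb := get_xb z in let xd := get_xd z in
  let ha := get_ha z in let hb := get_hb z in let hd := get_hd z in
  let y0 := C0a S *m xa + C0b S *m xb + C0d S *m xd + u0 t in
  let yb := Cb S *m xb in
  let yd := Cd S *m xd in
  let dxa := Aa S *m xa + Hab S *m (Cb S *m xb) + Had S *m (Cd S *m xd) + B0a S *m y0 in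
  let dxb := Ab S *m xb + Hbd S *m (Cd S *m xd) + B0b S *m y0 in
  let dxd := Bd S *m (Fda S *m xa) + Bd S *m (Fdb S *m xb) + Ad S *m xd
             + B0d S *m y0 + Bd S *m ud t in
  let dha := Aa S *m ha + Hab S *m yb + Had S *m yd + B0a S *m y0 in
  let dhb := Ab S *m hb + Hbd S *m yd + B0b S *m y0 + Lb *m (yb - Cb S *m hb) in
  let dhd := (Adstar S + Bd S *m Fdd S) *m hd
             + Bd S *m (Fda S *m ha + Fdb S *m hb) + B0d S *m y0 + Hdd S *m yd
             + ld kappa (yd - Cd S *m hd) in
  col_mx (col_mx (col_mx dxa dxb) dxd) (col_mx (col_mx dha dhb) dhd).
End ClosedLoop.

Section Filippov.
Context {R : realType} {N : nat}.

Definition box (a b : 'cV[R]_N) : set 'cV[R]_N :=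
  [set x | forall i, a i 0 <= x i 0 <= b i 0].
Definition vol (a b : 'cV[R]_N) : R := \prod_(i < N) (b i 0 - a i 0).

Definition null_set (Z : set 'cV[R]_N) : Prop :=
  forall eps : R, 0 < eps -> exists a b : nat -> 'cV[R]_N,
    [/\ (forall k i, a k i 0 <= b k i 0),
        (forall x, Z x -> exists k, box (a k) (b k) x) &
        (forall n, \sum_(k < n) vol (a k) (b k) < eps)].

Definition conv (A : set 'cV[R]_N) : set 'cV[R]_N :=
  [set v : 'cV[R]_N | exists n (p : 'I_n -> R) (w : 'I_n -> 'cV[R]_N),
     [/\ (forall k, 0 <= p k), \sum_(k < n) p k = 1, (forall k, A (w k)) &
         v = \sum_(k < n) p k *: w k]].

Definition clos (A : set 'cV[R]_N) : set 'cV[R]_N :=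
  [set v : 'cV[R]_N | forall eps : R, 0 < eps -> exists w, A w /\ forall i, `|v i 0 - w i 0| < eps].

Definition filippov (F : 'cV[R]_N -> 'cV[R]_N) (x : 'cV[R]_N) : set 'cV[R]_N :=
  [set v : 'cV[R]_N | forall delta : R, 0 < delta -> forall Z, null_set Z ->
     clos (conv (F @` [set y : 'cV[R]_N | (forall i, `|y i 0 - x i 0| < delta) /\ ~ Z y])) v].

Definition abs_cont_on (f : R -> R) (a b : R) : Prop :=
  forall eps : R, 0 < eps -> exists2 delta : R, 0 < delta &
    forall n (s t : 'I_n -> R),
      (forall k, a <= s k /\ s k <= t k /\ t k <= b) ->
      (forall k k', k != k' -> t k <= s k' \/ t k' <= s k) ->
      \sum_(k < n) (t k - s k) < delta ->
      \sum_(k < n) `|f (t k) - f (s k)| < eps.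

Definition filippov_solution (F : R -> 'cV[R]_N -> 'cV[R]_N) (z : R -> 'cV[R]_N) : Prop :=
  (forall (i : 'I_N) (T : R), 0 <= T -> abs_cont_on (fun s => z s i 0) 0 T) /\
  (@lebesgue_measure R).-negligible
    [set t | 0 <= t /\
       ~ ((forall i : 'I_N, derivable (fun s => z s i 0) t 1) /\
          filippov (F t) (z t) (\col_(i < N) (fun s => z s i 0)^`() t))].
End Filippov.

(* Main.v *)
(** The estimation errors of [x_a] and [x_b] solve linear systems with Hurwitz
    matrices, hence vanish asymptotically; the error of [x_d] splits into chains,
    block [i] being an arbitrary-order differentiator error system whose only
    disturbances are [u_{d,i}], the two vanishing errors, and the errors of the
    blocks before [i].  By induction on [i] the latter are already zero, so the
    disturbance is eventually bounded by [Delta_i + 1], and it remains to find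
    gains making one chain finite-time stable under a bounded disturbance.

    For one chain give the coordinates the homogeneity weights [q, ..., 1] and
    take the smooth homogeneous Lyapunov function of Cruz-Zavala and Moreno, a sum
    of Young-inequality gaps between consecutive coordinates.  The gains are
    chosen from the innermost coordinate outwards: adding an outermost coordinate
    adds to the derivative a term [- K g] with [g >= 0] vanishing only where the
    new coordinate tracks the old output, and there the old decay estimate holds;
    compactness of the homogeneous sphere then gives decay for large [K].
    Homogeneity of degree [-1] makes the Lyapunov function reach zero in finite
    time. *)
Require Import Defs.
From HB Require Import structures.
From mathcomp Require Import all_boot all_order all_algebra.
From mathcomp Require Import all_classical all_reals all_analysis.
From mathcomp Require Import complex.
From mathcomp Require Import ring lra zify.
Import Order.TTheory GRing.Theory Num.Theory.
Import numFieldNormedType.Exports.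
Local Open Scope ring_scope.
Local Open Scope classical_set_scope.

Set Implicit Arguments. Unset Strict Implicit. Unset Printing Implicit Defensive.

(** * Absolutely continuous functions *)

Section AbsolutelyContinuous.
Context {R : realType}.
Implicit Types (f g : R -> R) (a b : R).
Local Notation mu := (@lebesgue_measure R).

(** The limit of difference quotients becomes a linear error estimate on both sides of [c]; the
    excluded point [y = c] is trivial. *)
Lemma is_derive_near f (c d e : R) : is_derive c 1 f d -> 0 < e ->
  exists2 h, 0 < h & forall y, `|y - c| < h -> `|f y - f c - d * (y - c)| <= e * `|y - c|.
Proof.
move=> [df fd] e0; move/cvgrPdist_le : df => /(_ e e0).
have -> : lim (h^-1 *: ((f \o shift c) (h *: 1) - f c) @[h --> 0^']) = d by [].
rewrite nearE => /nbhs_ballP[h /= h0 H]; exists h => // y yc.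
have [->|yc0] := eqVneq y c; first by rewrite !subrr mulr0 subrr !normr0 mulr0.
have := H (y - c); rewrite /ball/= sub0r normrN subr_eq0 => /(_ yc yc0).
rewrite /shift/= scaler1 subrK /GRing.scale/= => {}H.
have -> : f y - f c - d * (y - c) = - ((d - (y - c)^-1 * (f y - f c)) * (y - c)).
  by field; rewrite subr_eq0.
by rewrite normrN normrM ler_wpM2r.
Qed.

Lemma abs_cont_onW f a b a' b' : a <= a' -> b' <= b ->
  abs_cont_on f a b -> abs_cont_on f a' b'.
Proof.
move=> aa bb H e e0; have [d d0 {}H] := H e e0; exists d => // n s t st.
by apply: H => k; have [? [? ?]] := st k; split=> //; lra.
Qed.

Lemma abs_cont_on1 f a b : abs_cont_on f a b -> forall e, 0 < e ->
  exists2 d, 0 < d & forall s t, a <= s -> s <= t -> t <= b -> t - s < d -> `|f t - f s| < e.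
Proof.
move=> H e e0; have [d d0 {}H] := H e e0; exists d => // s t as_ st tb tsd.
have := H 1%N (fun=> s) (fun=> t); rewrite !big_ord1; apply => //.
by move=> k k'; rewrite !ord1 eqxx.
Qed.

Lemma lebesgue_measureS (A B : set R) :
  @measurable _ (measurableTypeR R) A -> @measurable _ (measurableTypeR R) B ->
  A `<=` B -> (mu A <= mu B)%E.
Proof. by move=> mA mB AB; apply: le_measure => //; apply/mem_set. Qed.

(* Growth of [f] is paid for either by the slope bound or by a nonoverlapping
   family of intervals inside an open cover of the exceptional set. *)
Lemma abs_cont_on_le f a b (E : set R) : a <= b -> abs_cont_on f a b ->
  mu.-negligible E ->
  (forall t, a <= t -> t <= b -> ~ E t -> exists2 d, is_derive t 1 f d & d <= 0) ->
  f b <= f a.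
Proof.
move=> ab fac [B [mB B0 EB]] fd; apply/ler_addgt0Pr => e' e'0.
(* The budget [e'] splits into slope [e] over length [b - a] plus one further [e] for the
   exceptional intervals. *)
pose e := e' / (b - a + 1).
have e0 : 0 < e by rewrite divr_gt0//; lra.
have [d d0 H] := fac e e0.
have [|U [oU BU Ud]] := lebesgue_regularity_outer mB _ d0; first by rewrite [X in (X < _)%E]B0 ltry.
have mU : @measurable _ (measurableTypeR R) U by exact: measurable_realfun.open_measurable.
have muU : (mu U < d%:E)%E.
  apply: le_lt_trans Ud; rewrite -[leRHS]adde0 -B0.
  rewrite -measureU//; first by rewrite setDKU.
  - exact: measurableD.
  - by rewrite setDE -setIA setICl setI0.
pose I x := U `&` `]-oo, x].
have mI x : @measurable _ (measurableTypeR R) (I x) by exact: measurableI.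
have IU x : (mu (I x) < d%:E)%E.
  by apply: le_lt_trans muU; apply: lebesgue_measureS => // ? [].
have If x : mu (I x) \is a fin_num.
  by rewrite ge0_fin_numE// (lt_trans (IU x))// ltry.
pose phi x := fine (mu (I x)).
have phid x : phi x < d by rewrite -lte_fin fineK.
have phi0 x : 0 <= phi x by rewrite fine_ge0.
have phiM x y : x <= y -> phi x <= phi y.
  move=> xy; rewrite -lee_fin !fineK//; apply: lebesgue_measureS => //.
  by apply: setIS => z /=; rewrite !in_itv/= => /le_trans; apply.
have phiU x y : x <= y -> `]x, y] `<=` U -> phi x + (y - x) <= phi y.
  move=> xy xyU; rewrite -lee_fin EFinD !fineK//.
  have -> : (y - x)%:E = mu `]x, y].
    by rewrite lebesgue_measure_itv/= lte_fin; case: ltgtP xy => //= -> _; rewrite subrr.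
  rewrite -measureU//; last first.
    by apply/seteqP; split=> // z [[_ /=]]; rewrite !in_itv/= => zx /andP[xz _]; lra.
  apply: lebesgue_measureS => //; first exact: measurableU.
  move=> z [[Uz /= zx]|/= zxy]; split=> //=.
  - by move: zx; rewrite !in_itv/= => /le_trans; apply.
  - exact: xyU.
  - by move: zxy; rewrite !in_itv/= => /andP[].
(* Real induction: [S x] says that the growth of [f] on [[a, x]] is within the slope budget plus the
   variation over ordered intervals of total length at most [phi x]. It remains to carry the
   supremum of [S] to [b]. *)
pose S x := [/\ a <= x, x <= b & exists n (s t : nat -> R),
  [/\ (forall k, (k < n)%N -> [/\ a <= s k, s k <= t k & t k <= x]),
      (forall k k', (k < k')%N -> (k' < n)%N -> t k <= s k'),
      \sum_(k < n) (t k - s k) <= phi x &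
      f x - f a <= e * (x - a) + \sum_(k < n) `|f (t k) - f (s k)|]].
pose good x y := f y - f x <= e * (y - x) \/ `]x, y] `<=` U.
have Sgood x y : S x -> x <= y -> y <= b -> good x y -> S y.
  move=> [ax xb [n [s [t [st no stp fx]]]]] xy yb gxy; split=> //; first lra.
  case: gxy => [fxy|xyU].
    exists n, s, t; split=> //.
    - by move=> k kn; have [? ? ?] := st k kn; split=> //; lra.
    - by rewrite (le_trans stp)// phiM.
    - have -> : y - a = (y - x) + (x - a) by ring.
      by rewrite mulrDr; lra.
  exists n.+1, (fun k => if (k < n)%N then s k else x), (fun k => if (k < n)%N then t k else y); split.
  - move=> k; rewrite ltnS leq_eqVlt => /predU1P[->|kn]; first by rewrite ltnn.
    by rewrite kn; have [? ? ?] := st k kn; split=> //; lra.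
  - move=> k k' kk'; rewrite ltnS leq_eqVlt => /predU1P[kn|kn].
      by move: kk'; rewrite kn ltnn => kn'; rewrite kn'; have [] := st k kn'.
    by rewrite kn (ltn_trans kk' kn); exact: no.
  - rewrite big_ord_recr/= ltnn; apply: le_trans (phiU x y xy xyU); rewrite lerD2r.
    by under eq_bigr do rewrite ltn_ord.
  - rewrite big_ord_recr/= ltnn.
    under eq_bigr do rewrite ltn_ord.
    have := ler_norm (f y - f x).
    have : e * (x - a) <= e * (y - a) by rewrite ler_wpM2l//; lra.
    by lra.
have Sa : S a.
  split=> //; exists 0%N, (fun=> 0), (fun=> 0); split=> //.
    by rewrite big_ord0.
  by rewrite big_ord0 !subrr mulr0 addr0.
have hS : has_sup S by split; [exists a|exists b => x []].
pose c := sup S.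
have ac : a <= c by apply: ub_le_sup => //; case: hS.
have cb : c <= b by apply: ge_sup; [exists a|move=> x []].
(* If [c] is exceptional, a neighbourhood lies in [U]; otherwise the derivative at [c] is
   nonpositive and the growth near [c] has slope at most [e]. *)
have [h h0 hgood] : exists2 h, 0 < h & forall x y, c - h < x -> x <= c -> c <= y -> y < c + h ->
    good x c /\ good c y.
  have [Ec|Ec] := pselect (E c).
    have /nbhs_ballP[h /= h0 hU] := open_nbhs_nbhs (conj oU (BU _ (EB _ Ec))).
    exists h => // x y cx xc cy yc; split; right => z /=; rewrite in_itv/= => /andP[z1 z2];
      by apply: hU; rewrite /ball/= ltr_norml; apply/andP; split; lra.
  have [df dc df0] := fd _ ac cb Ec.
  have [h h0 hh] := is_derive_near dc e0.
  exists h => // x y cx xc cy yc; split; left.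
    have := hh x; rewrite ler0_norm ?subr_le0// => /(_ ltac:(lra)).
    rewrite ler_norml => /andP[+ _].
    have : 0 <= df * (x - c) by rewrite mulr_le0//; lra.
    by lra.
  have := hh y; rewrite ger0_norm ?subr_ge0// => /(_ ltac:(lra)).
  rewrite ler_norml => /andP[_].
  have : df * (y - c) <= 0 by rewrite mulr_le0_ge0//; lra.
  by lra.
have Sc : S c.
  have [x Sx xc] := sup_adherent h0 hS.
  have xc' : x <= c by apply: ub_le_sup => //; case: hS.
  apply: (Sgood _ _ Sx xc' cb).
  by have [] := hgood x c xc xc' (lexx _) ltac:(lra).
have cbE : c = b.
  apply/eqP; rewrite eq_le cb/= leNgt; apply/negP => cltb.
  pose y := Num.min (c + h / 2) b.
  have cy : c < y by rewrite lt_min cltb andbT; lra.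
  have yh : y < c + h by rewrite gt_min; apply/orP; left; lra.
  have yb : y <= b by rewrite ge_min lexx orbT.
  have Sy : S y.
    apply: (Sgood _ _ Sc (ltW cy) yb).
    by have [] := hgood c y ltac:(lra) (lexx _) (ltW cy) yh.
  have : y <= c by apply: ub_le_sup => //; case: hS.
  by rewrite leNgt cy.
move: Sc; rewrite cbE => -[_ _ [n [s [t [st no stp fb]]]]].
have {}H : \sum_(k < n) `|f (t k) - f (s k)| < e.
  apply: (H n (fun k => s k) (fun k => t k)).
  - by move=> k; have [] := st k (ltn_ord k).
  - move=> k k' kk'; have [/no|/no|/ord_inj kE] := ltngtP k k'; [left|right|]; auto.
    by rewrite kE eqxx in kk'.
  - exact: le_lt_trans stp (phid _).
have eE : e * (b - a) + e = e' by rewrite /e; field; lra.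
lra.
Qed.

Lemma abs_cont_on_cst c a b : abs_cont_on (fun=> c) a b.
Proof.
by move=> e e0; exists 1 => // n s t _ _ _; under eq_bigr do rewrite subrr normr0; rewrite big1.
Qed.

(** Single source of the closure properties below: increments controlled by those of two absolutely
    continuous functions inherit the property. *)
Lemma abs_cont_on_lip2 f g h a b L : 0 <= L ->
  (forall s t, a <= s -> s <= t -> t <= b ->
    `|h t - h s| <= L * (`|f t - f s| + `|g t - g s|)) ->
  abs_cont_on f a b -> abs_cont_on g a b -> abs_cont_on h a b.
Proof.
move=> L0 H fac gac e e0.
have e'0 : 0 < e / (2 * (L + 1)) by rewrite divr_gt0// mulr_gt0//; lra.
have [d1 d10 H1] := fac _ e'0; have [d2 d20 H2] := gac _ e'0.
exists (Num.min d1 d2); first by rewrite lt_min d10.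
move=> n s t st no; rewrite lt_min => /andP[sd1 sd2].
apply: (@le_lt_trans _ _ (\sum_(k < n) L * (`|f (t k) - f (s k)| + `|g (t k) - g (s k)|))).
  by apply: ler_sum => k _; have [? [? ?]] := st k; apply: H.
rewrite -mulr_sumr big_split/=.
have {}H1 := H1 _ _ _ st no sd1; have {}H2 := H2 _ _ _ st no sd2.
apply: (@le_lt_trans _ _ (L * (e / (2 * (L + 1)) + e / (2 * (L + 1))))).
  by rewrite ler_wpM2l// ltW// ltrD.
have -> : L * (e / (2 * (L + 1)) + e / (2 * (L + 1))) = e * (L / (L + 1)) by field; lra.
by rewrite gtr_pMr// ltr_pdivrMr; lra.
Qed.

Lemma abs_cont_on_lip f (h : R -> R) a b L : 0 <= L ->
  (forall s t, a <= s -> s <= t -> t <= b -> `|h t - h s| <= L * `|f t - f s|) ->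
  abs_cont_on f a b -> abs_cont_on h a b.
Proof.
move=> L0 H fac; apply: (abs_cont_on_lip2 L0 _ fac (@abs_cont_on_cst 0 a b)) => s t as_ st tb.
by rewrite subrr normr0 addr0 H.
Qed.

Lemma abs_cont_onD f g a b : abs_cont_on f a b -> abs_cont_on g a b ->
  abs_cont_on (fun t => f t + g t) a b.
Proof.
apply: abs_cont_on_lip2 ler01 _ => s t _ _ _; rewrite mul1r opprD addrACA.
exact: ler_normD.
Qed.

Lemma abs_cont_on_id a b : abs_cont_on id a b.
Proof.
move=> e e0; exists e => // n s t st _ le.
by under eq_bigr => k _ do rewrite ger0_norm ?subr_ge0 ?(proj1 (proj2 (st k)))//.
Qed.

Lemma abs_cont_onZ (c : R) f a b : abs_cont_on f a b -> abs_cont_on (fun t => c * f t) a b.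
Proof.
by apply: abs_cont_on_lip (normr_ge0 c) _ => s t _ _ _; rewrite -mulrBr normrM.
Qed.

Lemma abs_cont_onB f g a b : abs_cont_on f a b -> abs_cont_on g a b ->
  abs_cont_on (fun t => f t - g t) a b.
Proof.
move=> fa ga; have := abs_cont_onD fa (abs_cont_onZ (-1) ga).
by under [X in abs_cont_on X]eq_fun do rewrite mulN1r.
Qed.

Lemma abs_cont_on_sum (I : Type) (r : seq I) (P : pred I) (F : I -> R -> R) a b :
  (forall i, abs_cont_on (F i) a b) -> abs_cont_on (fun t => \sum_(i <- r | P i) F i t) a b.
Proof.
move=> H; elim: r => [|i r IH].
  have -> : (fun t => \sum_(i <- [::] | P i) F i t) = fun=> 0 by apply/funext => t; rewrite big_nil.
  exact: (abs_cont_on_cst 0).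
have -> : (fun t => \sum_(i <- i :: r | P i) F i t) =
    fun t => (if P i then F i t else 0) + \sum_(i <- r | P i) F i t.
  by apply/funext => t; rewrite big_cons; case: ifP; rewrite ?add0r.
apply: abs_cont_onD IH; case: (P i); [exact: H|exact: (abs_cont_on_cst 0)].
Qed.

(** Steps of length [d / 2] change [f] by less than 1, and finitely many of them cross the
    interval. *)
Lemma abs_cont_on_bounded f a b : abs_cont_on f a b ->
  exists2 B, 0 < B & forall t, a <= t -> t <= b -> `|f t| <= B.
Proof.
move=> fac; have [d d0 fd] := abs_cont_on1 fac ltr01.
have H n t : a <= t -> t <= b -> t - a <= n%:R * (d / 2) -> `|f t| <= `|f a| + n%:R.
  elim: n t => [|n IH] t at_ tb; first by rewrite mul0r addr0 => ta; have -> : t = a by lra.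
  rewrite -natr1 mulrDl mul1r => tn.
  have [tl|tl] := leP (t - a) (d / 2).
    have := fd a t (lexx _) at_ tb ltac:(lra); have := ler_normD (f t - f a) (f a).
    by rewrite subrK; have : 0 <= n%:R :> R by []; lra.
  have := IH (t - d / 2) ltac:(lra) ltac:(lra) ltac:(lra).
  have := fd (t - d / 2) t ltac:(lra) ltac:(lra) tb ltac:(lra).
  by have := ler_normD (f t - f (t - d / 2)) (f (t - d / 2)); rewrite subrK; lra.
pose n := Num.bound ((b - a) / (d / 2)).
exists (`|f a| + n%:R + 1) => [|t at_ tb].
  by have := normr_ge0 (f a); have : 0 <= n%:R :> R by []; lra.
apply: le_trans (H n t at_ tb _) _; last by lra.
rewrite -ler_pdivrMr; last by lra.
apply: le_trans (ltW (archi_boundP _)); last by rewrite divr_ge0//; lra.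
by rewrite ler_wpM2r// ?invr_ge0; lra.
Qed.

Lemma abs_cont_onM f g a b : abs_cont_on f a b -> abs_cont_on g a b ->
  abs_cont_on (fun t => f t * g t) a b.
Proof.
move=> fac gac; have [B B0 fB] := abs_cont_on_bounded fac.
have [C C0 gC] := abs_cont_on_bounded gac.
apply: (@abs_cont_on_lip2 f g _ _ _ (B + C)) => //; first lra.
move=> s t as_ st tb.
have -> : f t * g t - f s * g s = (f t - f s) * g t + f s * (g t - g s) by ring.
apply: (le_trans (ler_normD _ _)); rewrite !normrM mulrDr lerD//.
  rewrite mulrC ler_wpM2r//; have := gC t ltac:(lra) tb; lra.
rewrite ler_wpM2r//; have := fB s as_ ltac:(lra); lra.
Qed.
End AbsolutelyContinuous.

(** * Signed powers and roots *)

Section SignedPowers.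
Context {R : realType}.
Implicit Types (a b c x y z w : R) (m n p r : nat).

(* [spow m x] is the signed power of exponent m + 1. *)
Definition spow m x : R := x * `|x| ^+ m.
(** Inverse of [spow r]: it turns a coordinate of weight r + 1 into one of weight 1. *)
Definition sroot r x : R := Num.sg x * `|x| `^ (r.+1%:R^-1).

Lemma normr_spow m x : `|spow m x| = `|x| ^+ m.+1.
Proof. by rewrite normrM normrX normr_id exprS. Qed.

Lemma spow0 m : spow m 0 = 0. Proof. by rewrite /spow mul0r. Qed.

Lemma spowM m c x : 0 <= c -> spow m (c * x) = c ^+ m.+1 * spow m x.
Proof. by move=> c0; rewrite /spow normrM exprMn (ger0_norm c0) exprS; ring. Qed.

Lemma spowN m x : spow m (- x) = - spow m x.
Proof. by rewrite /spow normrN mulNr. Qed.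

Lemma spow_sg m x : spow m x = Num.sg x * `|x| ^+ m.+1.
Proof. by rewrite /spow {1}[x]numEsg -mulrA -exprS. Qed.

Lemma spow_lt m x y : x < y -> spow m x < spow m y.
Proof.
have pos z w : 0 <= z -> z < w -> spow m z < spow m w.
  move=> z0 zw; rewrite /spow !ger0_norm ?(ltW (le_lt_trans z0 zw))// -!exprS.
  by rewrite ltrXn2r// (ltW (le_lt_trans z0 zw)).
move=> xy; have [x0|x0] := leP 0 x; first exact: pos.
have [y0|y0] := leP y 0.
  by rewrite -ltrN2 -!spowN; apply: pos; lra.
apply: (@lt_trans _ _ (spow m 0)); last exact: pos.
by rewrite -ltrN2 -!spowN oppr0; apply: pos; lra.
Qed.

Lemma spow_inj m : injective (spow m).
Proof.
by move=> x y E; case: (ltgtP x y) => // /(spow_lt m); rewrite E ltxx.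
Qed.

(** Signed powers are increasing, so both factors carry the sign of [x - y], whatever the
    exponents. *)
Lemma spowB_ge0 m n x y : 0 <= (spow m x - spow m y) * (spow n x - spow n y).
Proof.
have [xy|xy|->] := ltgtP x y; last by rewrite !subrr mulr0.
- by rewrite mulr_le0// subr_le0 ltW// spow_lt.
- by rewrite mulr_ge0// subr_ge0 ltW// spow_lt.
Qed.

Lemma spowB_eq0 m n x y : (spow m x - spow m y) * (spow n x - spow n y) = 0 -> x = y.
Proof. by move/eqP; rewrite mulf_eq0 !subr_eq0 => /orP[] /eqP /spow_inj. Qed.

Lemma sg_sroot r x : Num.sg (sroot r x) = Num.sg x.
Proof.
rewrite /sroot sgrM sgr_id; have [->|x0] := eqVneq x 0; first by rewrite sgr0 mul0r.
by rewrite (gtr0_sg (powR_gt0 _ _)) ?mulr1// normr_gt0.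
Qed.

Lemma normr_sroot r x : `|sroot r x| = `|x| `^ (r.+1%:R^-1).
Proof.
rewrite /sroot normrM normr_sg ger0_norm ?powR_ge0//.
by have [->|] := eqVneq x 0; rewrite ?mul1r// normr0 powR0 ?mulr0// invr_eq0 pnatr_eq0.
Qed.

Lemma normr_srootX r m x : `|sroot r x| ^+ m = `|x| `^ (m%:R / r.+1%:R).
Proof. by rewrite normr_sroot -powR_mulrn ?powR_ge0// -powRrM mulrC. Qed.

Lemma srootK r x : spow r (sroot r x) = x.
Proof.
by rewrite spow_sg sg_sroot normr_srootX divff ?pnatr_eq0// powRr1// -numEsg.
Qed.

Lemma sroot0 r : sroot r 0 = 0.
Proof. by rewrite /sroot sgr0 mul0r. Qed.

Lemma sroot_eq0 r x : sroot r x = 0 -> x = 0.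
Proof. by move=> H; rewrite -(srootK r x) H spow0. Qed.

(** The difference quotient at 0 is at most [|h| ^ (b - 1)]. This settles the origin, where the
    power rule does not apply. *)
Lemma derive_dominated b (F : R -> R) : 1 < b -> (forall z, `|F z| <= `|z| `^ b) ->
  is_derive (0 : R) 1 F 0.
Proof.
move=> b1 FH; have b0 : 0 < b by lra.
have F0 : F 0 = 0.
  by apply/eqP; rewrite -normr_le0 (le_trans (FH 0))// normr0 powR0// gt_eqF.
have lim : h^-1 *: ((F \o shift 0) (h *: 1) - F 0) @[h --> 0^'] --> (0 : R).
  apply/cvgrPdist_le => e e0; rewrite nearE; apply/nbhs_ballP.
  exists (Num.min 1 (e `^ (b - 1)^-1)) => /=; first by rewrite lt_min ltr01 powR_gt0.
  move=> h; rewrite /ball/= !sub0r !normrN lt_min => /andP[h1 he] h0.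
  rewrite /shift/= scaler1 addr0 F0 subr0 /GRing.scale/=.
  have nh : 0 < `|h| by rewrite normr_gt0.
  rewrite normrM normfV mulrC ler_pdivrMr// (le_trans (FH h))//.
  have -> : `|h| `^ b = `|h| `^ (b - 1) * `|h|.
    by rewrite -[X in _ * X]powRr1 ?ltW// -powRD ?subrK// (gt_eqF nh) implybT.
  rewrite ler_wpM2r//.
  have -> : e = (e `^ (b - 1)^-1) `^ (b - 1) by rewrite -powRrM mulVf ?powRr1 ?ltW//; lra.
  by apply: ge0_ler_powR; rewrite ?nnegrE ?powR_ge0// ?ltW//; lra.
by apply: DeriveDef; [apply/cvg_ex; exists 0|exact: cvg_lim lim].
Qed.

Lemma derive_norm_powR b x : 1 < b ->
  is_derive x 1 (fun z => `|z| `^ b) (b * (Num.sg x * `|x| `^ (b - 1))).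
Proof.
move=> b1; have b0 : 0 < b by lra.
have pos z : 0 < z -> is_derive z 1 (fun z => `|z| `^ b) (b * z `^ (b - 1)).
  move=> z0; apply: (near_eq_is_derive _ (is_derive1_powR b z0)) => //.
  near=> w; rewrite ger0_norm// ltW//; near: w; exact: lt_nbhsr.
have [x0|x0|->] := ltgtP x 0.
- have := pos (- x); rewrite oppr_gt0 => /(_ x0) H.
  have -> : (fun z => `|z| `^ b) = (fun z => `|z| `^ b) \o -%R.
    by apply/funext => z /=; rewrite normrN.
  apply: is_derive_eq; rewrite ltr0_sg// ltr0_norm//; ring.
- by rewrite gtr0_sg// gtr0_norm// mul1r; exact: pos.
- rewrite sgr0 mul0r mulr0; apply: (derive_dominated b1) => z.
  by rewrite ger0_norm ?powR_ge0.
Unshelve. all: by end_near.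
Qed.

Lemma derive_sg_powR b x : 1 < b ->
  is_derive x 1 (fun z => Num.sg z * `|z| `^ b) (b * `|x| `^ (b - 1)).
Proof.
move=> b1; have b0 : 0 < b by lra.
have pos z : 0 < z -> is_derive z 1 (fun z => Num.sg z * `|z| `^ b) (b * z `^ (b - 1)).
  move=> z0; apply: (near_eq_is_derive _ (is_derive1_powR b z0)) => //.
  near=> w; have w0 : 0 < w by near: w; exact: lt_nbhsr.
  by rewrite gtr0_sg// gtr0_norm// mul1r.
have [x0|x0|->] := ltgtP x 0.
- have := pos (- x); rewrite oppr_gt0 => /(_ x0) H.
  have -> : (fun z => Num.sg z * `|z| `^ b) = -%R \o (fun z => Num.sg z * `|z| `^ b) \o -%R.
    by apply/funext => z /=; rewrite normrN sgrN; ring.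
  apply: is_derive_eq; rewrite ltr0_norm//; ring.
- by rewrite gtr0_norm//; exact: pos.
- rewrite normr0 powR0 ?gt_eqF ?subr_gt0// mulr0; apply: (derive_dominated b1) => z.
  rewrite normrM normr_sg (ger0_norm (powR_ge0 _ _)) ler_piMl ?powR_ge0//.
  by case: (z == 0).
Unshelve. all: by end_near.
Qed.

(* Chain rule for homogeneous terms: [sroot r x] has weight 1 when [x] has weight r + 1. *)
Lemma derive_norm_root r m x : (r.+1 < m)%N ->
  is_derive x 1 (fun z => `|sroot r z| ^+ m)
    (m%:R / r.+1%:R * spow (m - r.+2) (sroot r x)).
Proof.
move=> rm; have r0 : 0 < r.+1%:R :> R by rewrite ltr0n.
have b1 : 1 < m%:R / r.+1%:R :> R by rewrite ltr_pdivlMr// mul1r ltr_nat.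
have -> : (fun z => `|sroot r z| ^+ m) = (fun z => `|z| `^ (m%:R / r.+1%:R)).
  by apply/funext => z; rewrite normr_srootX.
apply: is_derive_eq (derive_norm_powR x b1) _.
rewrite spow_sg sg_sroot normr_srootX -subSn// subSS natrB ?(ltnW rm)//.
by rewrite mulrBl divff// gt_eqF.
Qed.

Lemma derive_spow_root r m x : (r < m)%N ->
  is_derive x 1 (fun z => spow m (sroot r z))
    (m.+1%:R / r.+1%:R * `|sroot r x| ^+ (m - r)).
Proof.
move=> rm; have r0 : 0 < r.+1%:R :> R by rewrite ltr0n.
have b1 : 1 < m.+1%:R / r.+1%:R :> R by rewrite ltr_pdivlMr// mul1r ltr_nat.
have -> : (fun z => spow m (sroot r z)) = (fun z => Num.sg z * `|z| `^ (m.+1%:R / r.+1%:R)).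
  by apply/funext => z; rewrite spow_sg sg_sroot normr_srootX.
apply: is_derive_eq (derive_sg_powR x b1) _.
have E : (m.+1 - r.+1 = m - r)%N by [].
by rewrite normr_srootX -E natrB 1?ltnW// mulrBl divff.
Qed.

End SignedPowers.

(** * Absolute continuity of powers and roots, and Young's inequality *)

Section AbsolutelyContinuousPowers.
Context {R : realType}.
Implicit Types (f F dF : R -> R) (a b : R).

(** By the mean value theorem [F] is Lipschitz on the range of [f]. Restricting to [[lo, hi]] admits
    functions such as powers below one, whose derivative blows up at 0. *)
Lemma abs_cont_on_comp_in f F dF a b (lo hi L : R) : 0 <= L ->
  (forall x, lo <= x -> x <= hi -> is_derive x 1 F (dF x) /\ `|dF x| <= L) ->
  (forall t, a <= t -> t <= b -> lo <= f t /\ f t <= hi) ->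
  abs_cont_on f a b -> abs_cont_on (fun t => F (f t)) a b.
Proof.
move=> L0 FL fr.
have lip x y : lo <= x -> x <= y -> y <= hi -> `|F y - F x| <= L * `|y - x|.
  move=> lox xy yhi.
  have Fd z : z \in `[x, y]%R -> is_derive z 1 F (dF z) /\ `|dF z| <= L.
    by rewrite in_itv/= => /andP[xz zy]; apply: FL; lra.
  have [||c cxy ->] := @MVT_segment R F dF x y xy.
  - by move=> z /subset_itv_oo_cc /Fd[].
  - apply: derivable_within_continuous => z /Fd[Fz _].
    by apply: ex_derive.
  by rewrite normrM ler_wpM2r//; have [] := Fd _ cxy.
apply: (abs_cont_on_lip L0) => s t as_ st tb.
have [s1 s2] := fr s as_ (le_trans st tb); have [t1 t2] := fr t (le_trans as_ st) tb.
by have [?|/ltW ?] := leP (f s) (f t); [|rewrite distrC [`|f t - _|]distrC]; apply: lip.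
Qed.

Lemma abs_cont_on_comp f F dF a b :
  (forall x : R, is_derive x 1 F (dF x)) ->
  (forall B : R, exists2 L : R, 0 <= L & forall x, `|x| <= B -> `|dF x| <= L) ->
  abs_cont_on f a b -> abs_cont_on (fun t => F (f t)) a b.
Proof.
move=> Fd FB fac; have [B B0 fB] := abs_cont_on_bounded fac.
have [L L0 FL] := FB B.
apply: (@abs_cont_on_comp_in f F dF a b (- B) B L) => //.
  by move=> x x1 x2; split=> //; apply: FL; rewrite ler_norml x1.
by move=> t ta tb; have := fB t ta tb; rewrite ler_norml => /andP[].
Qed.

Lemma normr_sroot_le r (x B : R) : `|x| <= B -> `|sroot r x| <= `|sroot r B|.
Proof.
move=> xB; rewrite !normr_sroot; apply: ge0_ler_powR; rewrite ?nnegrE//.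
by rewrite (le_trans xB)// ler_norm.
Qed.

Lemma abs_cont_on_norm_root r m f a b : (r.+1 < m)%N -> abs_cont_on f a b ->
  abs_cont_on (fun t => `|sroot r (f t)| ^+ m) a b.
Proof.
move=> rm; apply: abs_cont_on_comp (fun x => derive_norm_root x rm) _ => B.
exists (m%:R / r.+1%:R * `|sroot r B| ^+ (m - r.+2).+1) => [|x xB].
  by rewrite mulr_ge0// ?divr_ge0// exprn_ge0.
rewrite normrM normr_spow ger0_norm ?divr_ge0// ler_wpM2l ?divr_ge0//.
by rewrite lerXn2r// ?nnegrE// normr_sroot_le.
Qed.

Lemma abs_cont_on_spow_root r m f a b : (r < m)%N -> abs_cont_on f a b ->
  abs_cont_on (fun t => spow m (sroot r (f t))) a b.
Proof.
move=> rm; apply: abs_cont_on_comp (fun x => derive_spow_root x rm) _ => B.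
exists (m.+1%:R / r.+1%:R * `|sroot r B| ^+ (m - r)) => [|x xB].
  by rewrite mulr_ge0// ?divr_ge0// exprn_ge0.
rewrite normrM normrX normr_id ger0_norm ?divr_ge0// ler_wpM2l ?divr_ge0//.
by rewrite lerXn2r// ?nnegrE// normr_sroot_le.
Qed.

(** Young's inequality for [u ^+ i] and [v ^+ j] with conjugate exponents (i + j) / i and (i + j) /
    j, cleared of denominators. *)
Lemma young_nat i j (u v : R) : 0 <= u -> 0 <= v -> (0 < i)%N -> (0 < j)%N ->
  (i + j)%:R * (u ^+ i * v ^+ j) <= i%:R * u ^+ (i + j) + j%:R * v ^+ (i + j).
Proof.
move=> u0 v0 i0 j0.
have i0' : 0 < i%:R :> R by rewrite ltr0n.
have j0' : 0 < j%:R :> R by rewrite ltr0n.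
have := @conjugate_powR R (u ^+ i) (v ^+ j) ((i%:R + j%:R) / i%:R) ((i%:R + j%:R) / j%:R).
rewrite !exprn_ge0// !divr_gt0 ?addr_gt0// => /(_ isT isT isT isT).
have -> : ((i%:R + j%:R) / i%:R)^-1 + ((i%:R + j%:R) / j%:R)^-1 = 1 :> R.
  by field; rewrite !gt_eqF// addr_gt0.
move=> /(_ erefl).
rewrite -!(powR_mulrn _ u0) -!(powR_mulrn _ v0) -!powRrM.
have -> : i%:R * ((i%:R + j%:R) / i%:R) = (i + j)%N%:R :> R by rewrite natrD; field; rewrite gt_eqF.
have -> : j%:R * ((i%:R + j%:R) / j%:R) = (i + j)%N%:R :> R by rewrite natrD; field; rewrite gt_eqF.
move=> H; have ij : 0 < (i + j)%N%:R :> R by rewrite ltr0n addn_gt0 i0.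
rewrite mulrC -ler_pdivlMr//; apply: (le_trans H).
rewrite le_eqVlt; apply/orP; left; apply/eqP; rewrite natrD; field.
by rewrite !gt_eqF// addr_gt0.
Qed.
End AbsolutelyContinuousPowers.

(** * The Lyapunov function of one chain *)

Section Lyapunov.
Context {R : realType} (p : nat).
Implicit Types (k w : nat -> R) (o s D a b c : R) (n r : nat).

(* Bregman-type penalty for [a] (weight r + 2) deviating from [b] (weight r + 1);
   [p] exceeds [2 r + 3] in every use, so the subtractions do not truncate. *)
Definition gap r b a : R :=
  r.+2%:R * `|a| ^+ p - p%:R * (spow r.+1 a * spow (p - r.+3) b) + (p - r.+2)%:R * `|b| ^+ p.
(** [dgap_hi] and [dgap_lo] are the partial derivatives of [gap] in the unrooted coordinates
    [spow r.+1 a] and [spow r b]. *)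
Definition dgap_hi r b a : R := p%:R * (spow (p - r.+3) a - spow (p - r.+3) b).
Definition dgap_lo r b a : R :=
  p%:R * (p - r.+2)%:R / r.+1%:R * (`|b| ^+ (p - r.+3 - r) * (spow r.+1 b - spow r.+1 a)).

(** Coordinate [r] is driven by its inner neighbour and corrected by the output power of the same
    weight r. At [r = 0] these are the disturbance [D] and a selection [s] of the sign of the
    output. *)
Definition drive D w r : R := if r is r'.+1 then spow r' (w r') else D.
Definition out s o r : R := if r is r'.+1 then spow r' o else s.

Fixpoint lyap n w : R :=
  if n is n'.+1 then lyap n' w + gap n' (w n') (w n) else `|w 0%N| ^+ p.

(* Derivative of [lyap n] along the normalized differentiator error dynamics
   whose injection terms are driven by the output [o]. *)
Fixpoint dlyap n k w o s D : R :=
  if n is n'.+1 then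
    dlyap n' k w o s D + dgap_lo n' (w n') (w n) * (k n' * (drive D w n' - out s o n'))
    + dgap_hi n' (w n') (w n) * (k n * (drive D w n - out s o n))
  else p%:R * spow (p - 2) (w 0%N) * (k 0%N * (D - s)).

Definition wsum n w : R := \sum_(i < n.+1) `|w i|.

(** Young's inequality with exponents r + 2 and p - r - 2 dominates the mixed term. *)
Lemma gap_ge0 r b a : (r.+2 < p)%N -> 0 <= gap r b a.
Proof.
move=> rp; have := @young_nat R r.+2 (p - r.+2) `|a| `|b| (normr_ge0 _) (normr_ge0 _) isT.
rewrite subn_gt0 rp subnKC ?(ltnW rp)// => /(_ isT) H.
have : p%:R * (spow r.+1 a * spow (p - r.+3) b) <= p%:R * (`|a| ^+ r.+2 * `|b| ^+ (p - r.+2)).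
  rewrite ler_wpM2l//; apply: le_trans (ler_norm _) _.
  by rewrite normrM !normr_spow -subSn// subSS.
rewrite /gap; lra.
Qed.

Lemma lyap_ge0 n w : (n.+1 < p)%N -> 0 <= lyap n w.
Proof.
elim: n => [|n IH] np /=; first by rewrite exprn_ge0.
by rewrite addr_ge0 ?IH ?gap_ge0// ltnW.
Qed.

(** Zeros propagate outwards: once the inner argument of a gap is 0, the gap is a multiple of the
    p-th power of the outer one. *)
Lemma lyap_eq0 n w : (n.+1 < p)%N -> lyap n w = 0 -> forall r, (r <= n)%N -> w r = 0.
Proof.
elim: n => [|n IH] np /=.
  move=> /eqP; rewrite expf_eq0 normr_eq0 => /andP[_ /eqP w0] r.
  by rewrite leqn0 => /eqP ->.
move=> /eqP; rewrite paddr_eq0 ?(lyap_ge0 _ (ltnW np)) ?(gap_ge0 _ _ np)// => /andP[/eqP V0 /eqP Z0].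
have {}IH := IH (ltnW np) V0.
move=> r; rewrite leq_eqVlt => /predU1P[->|]; last exact: IH.
move: Z0; rewrite /gap (IH n (leqnn n)) spow0 normr0 expr0n gtn_eqF ?(leq_trans _ np)// !mulr0 subr0 addr0.
by move/eqP; rewrite mulf_eq0 pnatr_eq0/= expf_eq0 normr_eq0 => /andP[_ /eqP].
Qed.

Lemma le_wsum n w r : (r <= n)%N -> `|w r| <= wsum n w.
Proof.
move=> rn; rewrite /wsum (bigD1 (Ordinal (rn : (r < n.+1)%N)))//= lerDl.
by apply: sumr_ge0 => i _; exact: normr_ge0.
Qed.

Lemma wsum_ge0 n w : 0 <= wsum n w.
Proof. by apply: sumr_ge0 => i _; exact: normr_ge0. Qed.

(** Every monomial has degree [p], and the coefficients of one gap sum to [2 * p] in absolute value.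
    This later turns decay in [wsum] into decay in [lyap]. *)
Lemma lyap_le n w : (n.+1 < p)%N -> lyap n w <= (2 * p * n.+1)%:R * wsum n w ^+ p.
Proof.
move=> np; suff H m : (m <= n)%N -> lyap m w <= (2 * p * m.+1)%:R * wsum n w ^+ p by exact: H.
have Np r : (r <= n)%N -> `|w r| ^+ p <= wsum n w ^+ p.
  by move=> rn; rewrite lerXn2r// ?nnegrE// ?wsum_ge0//; exact: le_wsum.
elim: m => [|m IH] mn /=.
  rewrite muln1; apply: le_trans (Np _ mn) _; rewrite ler_peMl ?exprn_ge0 ?wsum_ge0//.
  by rewrite ler1n; lia.
rewrite mulnS natrD mulrDl addrC lerD ?IH 1?ltnW//.
rewrite /gap; have rp : (m.+2 < p)%N by lia.
apply: (@le_trans _ _ (m.+2%:R * `|w m.+1| ^+ p + p%:R * wsum n w ^+ p + (p - m.+2)%:R * `|w m| ^+ p)).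
  rewrite lerD2r lerD2l -mulrN ler_wpM2l//; apply: le_trans (ler_norm _) _.
  rewrite normrN normrM !normr_spow.
  apply: (@le_trans _ _ (wsum n w ^+ m.+2 * wsum n w ^+ (p - m.+3).+1)).
    by rewrite ler_pM ?exprn_ge0// lerXn2r// ?nnegrE ?wsum_ge0// le_wsum// ltnW.
  by rewrite -exprD (_ : (m.+2 + (p - m.+3).+1 = p)%N)//; lia.
have E : (2 * p)%:R = m.+2%:R + p%:R + (p - m.+2)%:R :> R by rewrite -!natrD; congr (_%:R); lia.
rewrite E [leRHS]mulrDl [X in _ <= X + _]mulrDl.
apply: lerD; last by apply: ler_wpM2l => //; apply: Np; lia.
by apply: lerD => //; apply: ler_wpM2l => //; apply: Np; lia.
Qed.

Lemma dgap_hi_ge0 r b a : 0 <= dgap_hi r b a * (spow r a - spow r b).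
Proof. by rewrite /dgap_hi -mulrA mulr_ge0// spowB_ge0. Qed.

Lemma dlyapS n k w o s D : dlyap n.+1 k w o s D =
  dlyap n k w o s D + dgap_lo n (w n) (w n.+1) * (k n * (drive D w n - out s o n))
  + dgap_hi n (w n) (w n.+1) * (k n.+1 * (drive D w n.+1 - out s o n.+1)).
Proof. by []. Qed.

Lemma dlyap_ext n k k' w w' o s D : (forall r, (r <= n)%N -> k r = k' r /\ w r = w' r) ->
  dlyap n k w o s D = dlyap n k' w' o s D.
Proof.
have dE r : (forall i, (i <= r)%N -> w i = w' i) -> drive D w r = drive D w' r.
  by case: r => //= r H; rewrite H.
elim: n => [|n IH] H /=; first by have [-> ->] := H 0%N isT.
rewrite (IH (fun r rn => H r (leqW rn))).
have [-> _] := H n.+1 (leqnn _); have [-> wn] := H n (leqnSn _).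
rewrite (dE n) => [|i /leqW /H[]//]; rewrite wn.
by have [_ ->] := H n.+1 (leqnn _).
Qed.

(** Homogeneity of degree -1: [lyap] has degree [p] and its derivative degree p - 1, since [s] and
    [D] have weight 0 and are not scaled. *)
Lemma dlyapM n k w o s D c : (n.*2.+1 < p)%N -> 0 <= c ->
  dlyap n k (fun r => c * w r) (c * o) s D = c ^+ p.-1 * dlyap n k w o s D.
Proof.
move=> np c0.
have dM r : drive D (fun i => c * w i) r - out s (c * o) r
   = c ^+ r * (drive D w r - out s o r).
  by case: r => [|r]/=; rewrite ?expr0 ?mul1r// !spowM// mulrBr.
elim: n np => [|n IH] np.
  rewrite /= spowM// (_ : (p - 2).+1 = p.-1); last by lia.
  by ring.
rewrite !dlyapS IH; last by lia.
rewrite !dM /dgap_hi /dgap_lo !spowM// normrM (ger0_norm c0) exprMn.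
rewrite (_ : p.-1 = (p - n.+3 - n + n.+2 + n)%N); last by lia.
rewrite (_ : (p - n.+3).+1 = (p - n.+3 - n + n.+1)%N); last by lia.
by rewrite !exprD !exprS; ring.
Qed.

Lemma is_derive_lyap n k w o s D (X : nat -> R -> R) t : (n.*2.+1 < p)%N ->
  (forall r, w r = sroot r (X r t)) ->
  (forall r, (r <= n)%N -> is_derive t 1 (X r) (k r * (drive D w r - out s o r))) ->
  is_derive t 1 (fun t => lyap n (fun r => sroot r (X r t))) (dlyap n k w o s D).
Proof.
move=> + wX; elim: n => [|n IH] np XD /=.
  apply: is_derive_eq; first exact: (is_derive1_comp (derive_norm_root (r:=0) (X 0%N t) np) (XD 0%N isT)).
  by rewrite wX /= divr1.
have Xn := XD n (leqnSn n); have Xn1 := XD n.+1 (leqnn _).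
have [n2p n1p nnp] : [/\ (n.*2.+1 < p)%N, (n.+2 < p)%N & (n < p - n.+3)%N] by split; lia.
have dV' : is_derive t 1 _ _ := IH n2p (fun r rn => XD r (leqW rn)).
have d1 : is_derive t 1 (fun t => `|sroot n.+1 (X n.+1 t)| ^+ p) _ :=
  is_derive1_comp (derive_norm_root (r:=n.+1) (X n.+1 t) n1p) Xn1.
have d2 : is_derive t 1 (fun t => spow (p - n.+3) (sroot n (X n t))) _ :=
  is_derive1_comp (derive_spow_root (r:=n) (m:=p - n.+3) (X n t) nnp) Xn.
have d3 : is_derive t 1 (fun t => `|sroot n (X n t)| ^+ p) _ :=
  is_derive1_comp (derive_norm_root (r:=n) (X n t) (ltnW n1p)) Xn.
(* In the mixed term the outer power is [X n.+1] itself, so the only powers left to differentiate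
   have exponent above one and are smooth enough at 0. *)
have -> : (fun t => lyap n (fun r => sroot r (X r t)) + gap n (sroot n (X n t)) (sroot n.+1 (X n.+1 t)))
  = (fun t => lyap n (fun r => sroot r (X r t))) + (n.+2%:R *: (fun t => `|sroot n.+1 (X n.+1 t)| ^+ p)
    - p%:R *: (X n.+1 * (fun t => spow (p - n.+3) (sroot n (X n t))))
    + (p - n.+2)%:R *: (fun t => `|sroot n (X n t)| ^+ p)).
  by apply/funext => u; rewrite /gap srootK.
refine (is_derive_eq (is_deriveD dV' (is_deriveD (is_deriveB (is_deriveZ n.+2%:R d1)
  (is_deriveZ p%:R (is_deriveM Xn1 d2))) (is_deriveZ (p - n.+2)%:R d3))) _).
have spE : spow (p - n.+2) (w n) = `|w n| ^+ (p - n.+3 - n) * spow n.+1 (w n).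
  by rewrite /spow mulrCA -exprD; congr (_ * _ ^+ _); lia.
have XE : X n.+1 t = spow n.+1 (w n.+1) by rewrite wX srootK.
have pE : (p - n.+3).+1 = (p - n.+2)%N by lia.
rewrite -!wX XE pE spE /dgap_hi /dgap_lo /GRing.scale/=.
set A := k n.+1 * _; set B := k n * _.
have n1 : n.+1%:R != 0 :> R by rewrite pnatr_eq0.
have n2 : n.+2%:R != 0 :> R by rewrite pnatr_eq0.
move: n1 n2; move: (n.+1%:R) (n.+2%:R) (p%:R) ((p - n.+2)%:R) => u v q l u0 v0.
move: (spow (p - n.+3) _) (spow (p - n.+3) _) (spow n.+1 _) (spow n.+1 _) (_ ^+ _) => f1 f2 f3 f4 f5.
by field; rewrite u0.
Qed.

Lemma abs_cont_on_lyap n (X : nat -> R -> R) a b : (n.*2.+1 < p)%N ->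
  (forall r, (r <= n)%N -> abs_cont_on (X r) a b) ->
  abs_cont_on (fun t => lyap n (fun r => sroot r (X r t))) a b.
Proof.
elim: n => [|n IH] np Xac /=; first by apply: abs_cont_on_norm_root => //; apply: Xac.
apply: abs_cont_onD; first by apply: IH => [|r rn]; [lia|apply: Xac; lia].
rewrite /gap.
have Xn := Xac n (leqnSn n); have Xn1 := Xac n.+1 (leqnn _).
apply: abs_cont_onD.
  apply: abs_cont_onB; first by apply/abs_cont_onZ/abs_cont_on_norm_root => //; lia.
  apply: abs_cont_onZ.
  have -> : (fun t => spow n.+1 (sroot n.+1 (X n.+1 t)) * spow (p - n.+3) (sroot n (X n t)))
    = fun t => X n.+1 t * spow (p - n.+3) (sroot n (X n t)).
    by apply/funext => t; rewrite srootK.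
  by apply: abs_cont_onM => //; apply: abs_cont_on_spow_root => //; lia.
by apply/abs_cont_onZ/abs_cont_on_norm_root => //; lia.
Qed.

End Lyapunov.

(** * Continuity, and domination by a large gain on a compact set *)

Section Penalty.
Context {R : realType} {T : topologicalType}.
Implicit Types f g : T -> R.

Lemma continuous_add f g : continuous f -> continuous g -> continuous (fun x => f x + g x).
Proof. by move=> cf cg x; apply: cvgD; [exact: cf|exact: cg]. Qed.

Lemma continuous_sub f g : continuous f -> continuous g -> continuous (fun x => f x - g x).
Proof. by move=> cf cg x; apply: cvgB; [exact: cf|exact: cg]. Qed.

Lemma continuous_mul f g : continuous f -> continuous g -> continuous (fun x => f x * g x).
Proof. by move=> cf cg x; apply: cvgM; [exact: cf|exact: cg]. Qed.

Lemma continuous_normX f m : continuous f -> continuous (fun x => `|f x| ^+ m).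
Proof.
move=> cf x; apply: (@cvg_comp _ _ _ (fun x => `|f x|) (fun y : R => y ^+ m)).
  by apply: cvg_norm; exact: cf.
exact: exprn_continuous.
Qed.

Lemma continuous_spow f m : continuous f -> continuous (fun x => spow m (f x)).
Proof. by move=> cf; apply: continuous_mul => //; exact: continuous_normX. Qed.

Lemma continuous_sum (I : Type) (r : seq I) (F : I -> T -> R) :
  (forall i, continuous (F i)) -> continuous (fun x => \sum_(i <- r) F i x).
Proof.
move=> cF; elim: r => [|i r IH].
  have -> : (fun x => \sum_(i <- [::]) F i x) = fun=> 0 by apply/funext => x; rewrite big_nil.
  by move=> x; exact: cvg_cst.
have -> : (fun x => \sum_(i <- i :: r) F i x) = fun x => F i x + \sum_(i <- r) F i x.
  by apply/funext => x; rewrite big_cons.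
exact: continuous_add.
Qed.

(** On the zeros of [g] the maximum of [f] is negative, which fixes [c]. On the compact part where
    [f >= - c], [g] has a positive minimum and a large [k] beats the maximum of [f]; elsewhere
    [f < - c] already. *)
Lemma compact_penalty (K : set T) f g : compact K -> continuous f -> continuous g ->
  (forall x, K x -> 0 <= g x) -> (forall x, K x -> g x = 0 -> f x < 0) ->
  exists k0 c, [/\ 0 <= k0, 0 < c & forall k x, k0 <= k -> K x -> f x - k * g x <= - c].
Proof.
move=> cK cf cg g0 fg.
have [c c0 Hc] : exists2 c, 0 < c & forall x, K x -> g x = 0 -> f x <= - (2 * c).
  have [[x0 Kx0]|noK] := pselect (exists x, (K `&` g @^-1` [set 0]) x); last first.
    by exists 1 => // x Kx gx; case: noK; exists x.
  have [|||x1 + Hx1] := @compact_EVT_max T R f (K `&` g @^-1` [set 0]).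
  - by exists x0.
  - apply: compact_closedI => //; apply: preimage_closed; last exact: closed_eq.
    by move=> x _; exact: cg.
  - exact: continuous_subspaceT.
  rewrite inE => -[Kx1 /= gx1].
  exists (- f x1 / 2); first by have := fg _ Kx1 gx1; lra.
  move=> x Kx gx; have := Hx1 x; rewrite inE => /(_ (conj Kx gx)); lra.
pose K1 := K `&` f @^-1` [set y | - c <= y].
have cK1 : compact K1.
  apply: compact_closedI => //; apply: preimage_closed; last exact: closed_ge.
  by move=> x _; exact: cf.
have [[x0 Kx0]|noK] := pselect (exists x, K1 x); last first.
  exists 0, c; split=> // k x k0 Kx; have := g0 x Kx => /(mulr_ge0 k0).
  have [fx|/ltW fx] := leP (- c) (f x); last by lra.
  by case: noK; exists x.
have [||x1 + Hx1] := @compact_EVT_min T R g K1 _ cK1; first by exists x0.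
  exact: continuous_subspaceT.
have [||x2 + Hx2] := @compact_EVT_max T R f K1 _ cK1; first by exists x0.
  exact: continuous_subspaceT.
rewrite !inE => -[Kx2 /= fx2] [Kx1 /= fx1].
have gx1 : 0 < g x1.
  rewrite lt_def g0// andbT; apply/eqP => gx1; have := Hc _ Kx1 gx1.
  have : - c <= f x1 := fx1; lra.
have {}fx2 : - c <= f x2 := fx2.
have k00 : 0 <= (f x2 + c) / g x1 by apply: divr_ge0; [lra|exact: ltW].
exists ((f x2 + c) / g x1), c; split=> // k x k0 Kx.
have kg := mulr_ge0 (le_trans k00 k0) (g0 x Kx).
have [fx|/ltW fx] := leP (- c) (f x); last by lra.
have K1x : K1 x by [].
have h1 := Hx1 x (mem_set K1x); have h2 := Hx2 x (mem_set K1x).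
have : f x2 + c <= k * g x.
  rewrite -(@divfK _ (g x1) _ (f x2 + c)) ?gt_eqF//.
  by apply: ler_pM => //; exact: ltW.
lra.
Qed.
End Penalty.

(** * Choice of the gains and decay of the Lyapunov function *)

Section Decay.
Context {R : realType} (p : nat).
Implicit Types (k w : nat -> R) (s D : R) (n r : nat).

Lemma continuous_drive (T : topologicalType) (w : T -> nat -> R) (o s D : T -> R) r :
  (forall r, continuous (fun x => w x r)) -> continuous o -> continuous s -> continuous D ->
  continuous (fun x => drive (D x) (w x) r - out (s x) (o x) r).
Proof.
by move=> cw co cs cD; case: r => [|r]; apply: continuous_sub => //; exact: continuous_spow.
Qed.

Lemma continuous_dgap_hi (T : topologicalType) (a b : T -> R) r :
  continuous a -> continuous b -> continuous (fun x => dgap_hi p r (b x) (a x)).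
Proof.
move=> ca cb; apply: continuous_mul; first by move=> x; exact: cvg_cst.
by apply: continuous_sub; exact: continuous_spow.
Qed.

Lemma continuous_dgap_lo (T : topologicalType) (a b : T -> R) r :
  continuous a -> continuous b -> continuous (fun x => dgap_lo p r (b x) (a x)).
Proof.
move=> ca cb; apply: continuous_mul; first by move=> x; exact: cvg_cst.
apply: continuous_mul; first exact: continuous_normX.
by apply: continuous_sub; exact: continuous_spow.
Qed.

Lemma continuous_dlyap (T : topologicalType) n k (w : T -> nat -> R) (o s D : T -> R) :
  (forall r, continuous (fun x => w x r)) -> continuous o -> continuous s -> continuous D ->
  continuous (fun x => dlyap p n k (w x) (o x) (s x) (D x)).
Proof.
move=> cw co cs cD.
have cst (c : R) : continuous (fun _ : T => c) by move=> x; exact: cvg_cst.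
elim: n => [|n IH].
  apply: continuous_mul.
    by apply: continuous_mul => //; exact: continuous_spow.
  by apply: continuous_mul => //; exact: continuous_sub.
apply: continuous_add; [apply: continuous_add => //|]; apply: continuous_mul.
- exact: continuous_dgap_lo.
- by apply: continuous_mul => //; exact: continuous_drive.
- exact: continuous_dgap_hi.
- by apply: continuous_mul => //; exact: (@continuous_drive _ _ _ _ _ n.+1).
Qed.

Lemma wsumM n w c : 0 <= c -> wsum n (fun r => c * w r) = c * wsum n w.
Proof.
by move=> c0; rewrite /wsum mulr_sumr; apply: eq_bigr => i _; rewrite normrM ger0_norm.
Qed.

Lemma dlyap_decay_step n k c : (n.*2.+3 < p)%N -> (forall r, 0 < k r) -> 0 < c ->
  (forall w s D, `|s| <= 1 -> s * w n = `|w n| -> `|D| <= 1 / 2 ->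
     dlyap p n k w (w n) s D <= - c * wsum n w ^+ p.-1) ->
  exists K c', [/\ 1 <= K, 0 < c' & forall w s D,
    `|s| <= 1 -> s * w n.+1 = `|w n.+1| -> `|D| <= 1 / 2 ->
    dlyap p n.+1 (fun r => if r == n.+1 then K else k r) w (w n.+1) s D
      <= - c' * wsum n.+1 w ^+ p.-1].
Proof.
move=> np kp c0 IH.
(* [s] and [D] become independent variables of a compact set. The discontinuous sign is replaced by
   the closed constraint [s * w = |w|], so everything is continuous. *)
pose T := ('rV[R]_n.+2 * (R * R))%type.
pose w_ (x : T) r := x.1 0 (inord r).
have cw r : continuous (fun x : T => w_ x r).
  by move=> x; apply: (@cvg_comp _ _ _ fst (fun v : 'rV[R]_n.+2 => v 0 (inord r)));
    [exact: cvg_fst|exact: coord_continuous].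
have cs : continuous (fun x : T => x.2.1).
  by move=> x; apply: (@cvg_comp _ _ _ snd fst); [exact: cvg_snd|exact: cvg_fst].
have cD : continuous (fun x : T => x.2.2).
  by move=> x; apply: (@cvg_comp _ _ _ snd snd); [exact: cvg_snd|exact: cvg_snd].
(* The derivative is split as [f - K * g]: [f] collects all terms free of the new gain, and [g] is
   nonnegative by monotonicity of signed powers. *)
pose f (x : T) := dlyap p n k (w_ x) (w_ x n.+1) x.2.1 x.2.2 +
  dgap_lo p n (w_ x n) (w_ x n.+1) * (k n * (drive x.2.2 (w_ x) n - out x.2.1 (w_ x n.+1) n)).
pose g (x : T) := dgap_hi p n (w_ x n) (w_ x n.+1) * (spow n (w_ x n.+1) - spow n (w_ x n)).
pose box : set T := [set v : 'rV[R]_n.+2 | forall i, `[(-1 : R), 1]%classic (v ord0 i)] `*`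
  (`[(-1 : R), 1] `*` `[(- (1 / 2) : R), 1 / 2]).
pose Sph : set T := (fun x => wsum n.+1 (w_ x)) @^-1` [set 1].
pose Sgn : set T := (fun x => x.2.1 * w_ x n.+1 - `|w_ x n.+1| ^+ 1) @^-1` [set 0].
have cN : continuous (fun x => wsum n.+1 (w_ x)).
  by apply: continuous_sum => i x; apply: cvg_norm; exact: cw.
have cK : compact (box `&` Sph `&` Sgn).
  apply: compact_closedI; first apply: compact_closedI.
  - apply: compact_setX; last by apply: compact_setX; exact: segment_compact.
    by apply: (@rV_compact _ _ (fun=> `[(-1 : R), 1]%classic)) => i; exact: segment_compact.
  - by apply: preimage_closed; [move=> x _; exact: cN|exact: closed_eq].
  - apply: preimage_closed; last exact: closed_eq.
    move=> x _; move: x; apply: continuous_sub; first exact: continuous_mul.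
    exact: continuous_normX.
have [K0 [c' [K00 c'0 Hk]]] : exists K0 c', [/\ 0 <= K0, 0 < c' &
    forall K x, K0 <= K -> (box `&` Sph `&` Sgn) x -> f x - K * g x <= - c'].
  apply: (compact_penalty cK).
  - apply: continuous_add; first exact: continuous_dlyap.
    apply: continuous_mul; first exact: continuous_dgap_lo.
    apply: continuous_mul; [by move=> x; apply: cvg_cst|exact: continuous_drive].
  - apply: continuous_mul; first exact: continuous_dgap_hi.
    by apply: continuous_sub; exact: continuous_spow.
  - by move=> x _; exact: dgap_hi_ge0.
  - move=> x [[[_ [/= xs xD]] xN] xS].
    move=> gx; have {}gx : w_ x n.+1 = w_ x n.
      apply: (@spowB_eq0 _ (p - n.+3) n).
      have p0 : p%:R != 0 :> R by rewrite pnatr_eq0; lia.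
      by apply/eqP; move/eqP: gx; rewrite /g /dgap_hi -mulrA mulf_eq0 (negbTE p0).
    (* Where [g] vanishes, the new coordinate equals the old output: the [dgap_lo] term disappears
       and the previous decay estimate applies. *)
    rewrite /f gx /dgap_lo subrr mulr0 mulr0 mul0r addr0.
    apply: le_lt_trans (IH _ _ _ _ _ _) _.
    + by rewrite ler_norml; move: xs; rewrite in_itv.
    + by move: xS; rewrite /Sgn /= expr1 gx => /eqP; rewrite subr_eq0 => /eqP.
    + by rewrite ler_norml; move: xD; rewrite in_itv.
    rewrite mulNr oppr_lt0 mulr_gt0// exprn_gt0// lt_def wsum_ge0 andbT.
    apply/eqP => N0; move: xN; rewrite /Sph /= /wsum big_ord_recr/= -/(wsum n (w_ x)) N0 add0r.
    rewrite gx => wn; have := le_wsum (w_ x) (leqnn n); rewrite N0 wn; lra.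
have Hw w s D : wsum n.+1 w = 1 -> `|s| <= 1 -> s * w n.+1 = `|w n.+1| -> `|D| <= 1 / 2 ->
    dlyap p n.+1 (fun r => if r == n.+1 then K0 + 1 else k r) w (w n.+1) s D <= - c'.
  move=> N1 s1 sw D2; pose x : T := (\row_i w i, (s, D)).
  have wx r : (r <= n.+1)%N -> w_ x r = w r by move=> rn; rewrite /w_ mxE inordK.
  have NE : wsum n.+1 (w_ x) = 1 by rewrite -N1; apply: eq_bigr => i _; rewrite wx// -ltnS.
  have -> : dlyap p n.+1 (fun r => if r == n.+1 then K0 + 1 else k r) w (w n.+1) s D
      = f x - (K0 + 1) * g x.
    pose k' r := if r == n.+1 then K0 + 1 else k r.
    rewrite -(wx n.+1 (leqnn _)) (@dlyap_ext _ p n.+1 k' k' w (w_ x)); last first.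
      by move=> r rn; rewrite wx.
    rewrite dlyapS (@dlyap_ext _ p n k' k (w_ x) (w_ x)); last first.
      by move=> r rn; rewrite /k' ltn_eqF.
    by rewrite /k' eqxx ltn_eqF// /f /g [drive _ _ n.+1]/= [out _ _ n.+1]/=; ring.
  apply: Hk; first by lra.
  split; last by rewrite /Sgn /= wx// sw expr1 subrr.
  split=> //; split=> /=; last by rewrite !in_itv/= -!ler_norml.
  move=> i; rewrite /= in_itv/= -ler_norml mxE -N1.
  by apply: le_wsum; rewrite -ltnS.
exists (K0 + 1), c'; split=> //; first by lra.
move=> w s D s1 sw D2.
(* The estimate on the unit sphere extends by homogeneity; the origin cannot be normalized and is
   treated as a scaling by 0. *)
have := wsum_ge0 n.+1 w; rewrite le_eqVlt => /predU1P[N0|N0].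
  have w0 r : (r <= n.+1)%N -> w r = 0.
    by move=> rn; apply/eqP; rewrite -normr_le0 N0 le_wsum.
  rewrite (@dlyap_ext _ p n.+1 _ (fun r => if r == n.+1 then K0 + 1 else k r) w (fun r => 0 * w r)).
    rewrite (_ : w n.+1 = 0 * w n.+1); last by rewrite w0// mulr0.
    rewrite dlyapM//.
    by rewrite -N0 expr0n gtn_eqF ?mul0r ?mulr0//; lia.
  by move=> r rn; rewrite mul0r w0.
set a := wsum n.+1 w in N0 *.
have E r : w r = a * (a^-1 * w r) by rewrite mulrA divff ?mul1r// gt_eqF.
rewrite (@dlyap_ext _ p n.+1 _ (fun r => if r == n.+1 then K0 + 1 else k r) w (fun r => a * (a^-1 * w r)));
  last by move=> r _; rewrite -E.
rewrite [w n.+1]E dlyapM ?(ltW N0)//.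
rewrite mulrC ler_wpM2r ?exprn_ge0 ?(ltW N0)//.
apply: (Hw (fun r => a^-1 * w r)) => //.
  by rewrite wsumM ?invr_ge0 ?(ltW N0)// -/a mulVf// gt_eqF.
by rewrite normrM mulrCA sw ger0_norm// invr_ge0 ltW.
Qed.

(** The product of the gains is kept above [B] so that rescaling can shrink any bounded disturbance
    to at most 1 / 2. Each new gain is at least 1 and preserves this bound. *)
Lemma dlyap_decay n B : (n.*2.+1 < p)%N ->
  exists k c, [/\ forall r, 0 < k r, B <= \prod_(i < n.+1) k i, 0 < c &
    forall w s D, `|s| <= 1 -> s * w n = `|w n| -> `|D| <= 1 / 2 ->
      dlyap p n k w (w n) s D <= - c * wsum n w ^+ p.-1].
Proof.
elim: n => [|n IH] np.
  pose b := Num.max 1 B.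
  have b0 : 0 < b by rewrite lt_max ltr01.
  have p0 : 0 < p%:R :> R by rewrite ltr0n; lia.
  exists (fun=> b), (p%:R * b / 2); split=> //.
  - by rewrite big_ord1 le_max lexx orbT.
  - by rewrite divr_gt0// mulr_gt0.
  move=> w s D s1 sw D2; rewrite /wsum big_ord1 /=.
  have -> : p%:R * spow (p - 2) (w 0%N) * (b * (D - s)) = (p%:R * b) * (spow (p - 2) (w 0%N) * D - spow (p - 2) (w 0%N) * s) by ring.
  have -> : spow (p - 2) (w 0%N) * s = `|w 0%N| ^+ p.-1.
    rewrite /spow -mulrA mulrCA mulrC [w 0%N * s]mulrC sw.
    by rewrite -exprS; congr (_ ^+ _); lia.
  have -> : - (p%:R * b / 2) * `|w 0%N| ^+ p.-1 = p%:R * b * (- `|w 0%N| ^+ p.-1 / 2) by field.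
  apply: ler_wpM2l; first by rewrite mulr_ge0// ltW.
  have : spow (p - 2) (w 0%N) * D <= `|w 0%N| ^+ p.-1 * (1 / 2).
    apply: le_trans (ler_norm _) _; rewrite normrM normr_spow.
    rewrite (_ : (p - 2).+1 = p.-1); last by lia.
    by rewrite ler_wpM2l// exprn_ge0.
  lra.
have [k [c [kp kB c0 H]]] := IH ltac:(lia).
have [K [c' [K1 c'0 H']]] := dlyap_decay_step np kp c0 H.
exists (fun r => if r == n.+1 then K else k r), c'; split=> //.
  by move=> r; case: ifP => // _; lra.
rewrite big_ord_recr/= eqxx.
have -> : \prod_(i < n.+1) (if (i : nat) == n.+1 then K else k i) = \prod_(i < n.+1) k i.
  by apply: eq_bigr => i _; rewrite ltn_eqF.
apply: (le_trans kB); rewrite ler_peMr// ltW// prodr_gt0//.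
Qed.

End Decay.

(** * Finite-time convergence of one chain *)

Section Chain.
Context {R : realType}.
Local Notation mu := (@lebesgue_measure R).
Implicit Types (f e : R -> R) (E : set R) (c T : R).

(** As long as [f] is positive, [f ^ al] decreases at rate at least [al * c], which cannot go on
    after a finite time. *)
Lemma finite_time_extinction f E (T0 c al : R) : 0 < c -> 0 < al -> al < 1 ->
  mu.-negligible E -> (forall T, abs_cont_on f T0 T) ->
  (forall t, T0 <= t -> 0 <= f t) ->
  (forall t, T0 <= t -> ~ E t -> exists2 d, is_derive t 1 f d & d <= - c * f t `^ (1 - al)) ->
  exists2 T1, T0 <= T1 & forall t, T1 <= t -> f t = 0.
Proof.
move=> c0 al0 al1 nE fac f0 fd.
have ac0 : 0 < al * c by rewrite mulr_gt0.
(* Time needed to exhaust [f T0 ^ al] at rate [al * c]; the added 1 makes the final contradiction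
   strict. *)
pose T1 := T0 + f T0 `^ al / (al * c) + 1.
have T01 : T0 + 1 <= T1 by rewrite /T1 lerD2r lerDl divr_ge0 ?powR_ge0// ltW.
exists T1 => [|t T1t]; first lra.
have T0t : T0 <= t by lra.
apply/eqP; rewrite eq_le f0// andbT leNgt; apply/negP => w0.
(* Monotonicity keeps [f] above [f t > 0] on [[T0, t]], away from the singularity of the power
   [al]. *)
have mono s u : T0 <= s -> s <= u -> f u <= f s.
  move=> T0s su; apply: (abs_cont_on_le su _ nE).
    by apply: abs_cont_onW (fac u).
  move=> v sv vu nEv; have [|d fdd dle] := fd v _ nEv; first lra.
  by exists d => //; apply: (le_trans dle); rewrite mulNr oppr_le0 mulr_ge0 ?powR_ge0// ltW.
have fpos s : T0 <= s -> s <= t -> f t <= f s /\ f s <= f T0.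
  by move=> s0 st; split; apply: mono.
pose g s := f s `^ al + al * c * s.
have gac : abs_cont_on g T0 t.
  apply: abs_cont_onD.
    apply: (@abs_cont_on_comp_in R f (fun x => x `^ al) (fun x => al * x `^ (al - 1)) T0 t
      (f t) (f T0) (al * f t `^ (al - 1))) (fac t) => //.
      by rewrite mulr_ge0 ?powR_ge0// ltW.
    move=> x xt _; have x0 : 0 < x by apply: lt_le_trans xt.
    split; first exact: is_derive1_powR.
    rewrite ger0_norm ?mulr_ge0 ?powR_ge0 ?(ltW al0)//; apply: ler_wpM2l; first exact: ltW.
    rewrite -(opprB 1 al) !powRN lef_pV2 ?posrE ?powR_gt0//.
    by apply: ge0_ler_powR; rewrite ?nnegrE// ?(ltW x0) ?(ltW w0)//; lra.
  by apply: abs_cont_onZ; exact: abs_cont_on_id.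
have gle : g t <= g T0.
  apply: (abs_cont_on_le T0t gac nE) => s T0s st nEs.
  have [d fdd dle] := fd s T0s nEs.
  have fs0 : 0 < f s by apply: lt_le_trans (proj1 (fpos s T0s st)).
  exists (al * f s `^ (al - 1) * d + al * c *: 1).
    have h1 : is_derive s 1 (fun s => f s `^ al) _ :=
      is_derive1_comp (is_derive1_powR al fs0) fdd.
    exact: (is_deriveD h1 (is_deriveZ (al * c) (is_derive_id s 1))).
  rewrite /GRing.scale/= mulr1 -!mulrA -mulrDr pmulr_rle0//.
  have : f s `^ (al - 1) * d <= f s `^ (al - 1) * (- c * f s `^ (1 - al)).
    by apply: ler_wpM2l => //; exact: powR_ge0.
  rewrite mulrCA -powRD ?(gt_eqF fs0) ?implybT// subrKA subrr powRr0 mulr1; lra.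
move: gle; rewrite /g => gle.
have : al * c * (t - T0) <= f T0 `^ al.
  by have := powR_ge0 (f t) al; rewrite mulrBr; lra.
rewrite mulrC -ler_pdivlMr//; rewrite /T1 in T1t; lra.
Qed.

Lemma spow_root_sigpow r n (z : R) :
  spow r (sroot n z) = sigpow z (r.+1%:R / n.+1%:R).
Proof.
rewrite spow_sg sg_sroot normr_srootX /sigpow ifF//.
by apply/negbTE; rewrite mulf_neq0 ?invr_eq0 ?pnatr_eq0.
Qed.

Lemma sgn_sroot n (s z : R) : s * z = `|z| -> s * sroot n z = `|sroot n z|.
Proof.
have [->|z0] := eqVneq z 0; first by rewrite sroot0 mulr0 normr0.
rewrite {1}[z]numEsg mulrA => /(congr1 (fun y => y / `|z|)).
rewrite mulfK ?divff ?normr_eq0// => sz.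
by rewrite {1}[sroot n z]numEsg sg_sroot mulrA sz mul1r.
Qed.

(* Coordinates are indexed by homogeneity weight minus one: [e n] is the measured
   output and [e 0] the coordinate hit by the disturbance. *)
Lemma differentiator_gains n (M : R) : 0 <= M ->
  exists kap : nat -> R, (forall r, 0 < kap r) /\
  forall (e : nat -> R -> R) E (T0 : R), mu.-negligible E ->
  (forall r T, (r <= n)%N -> abs_cont_on (e r) T0 T) ->
  (forall t, T0 <= t -> ~ E t -> exists d s,
    [/\ `|d| <= M, `|s| <= 1, s * e n t = `|e n t|,
        is_derive t 1 (e 0%N) (d - kap 0%N * s) &
        forall r, (r < n)%N -> is_derive t 1 (e r.+1)
          (e r t - kap r.+1 * sigpow (e n t) (r.+1%:R / n.+1%:R))]) ->
  exists2 T1, T0 <= T1 & forall t r, T1 <= t -> (r <= n)%N -> e r t = 0.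
Proof.
move=> M0; pose p := n.*2.+2.
have np : (n.*2.+1 < p)%N by [].
have [k [c [k0 kB c0 H]]] := @dlyap_decay R p n (2 * M) np.
(* With [kap r] the product of the normalized gains from [r] to [n], dividing [e r] by [kap r.+1]
   gives the normalized equations with gains [k r]. The disturbance becomes [d / kap 0], and
   [kap 0 >= 2 * M]. *)
pose kap r := \prod_(r <= i < n.+1) k i.
have kap0 r : 0 < kap r by apply: prodr_gt0.
have kapS r : (r <= n)%N -> kap r = k r * kap r.+1 by move=> rn; rewrite /kap big_ltn.
have kapn : kap n.+1 = 1 by rewrite /kap big_geq.
exists kap; split=> // e E T0 nE eac ed.
pose X r t := (kap r.+1)^-1 * e r t.
have XE r t : e r t = kap r.+1 * X r t by rewrite /X mulrA divff ?mul1r// gt_eqF.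
have XnE t : X n t = e n t by rewrite /X kapn invr1 mul1r.
pose w t r := sroot r (X r t).
pose W t := lyap p n (w t).
have n1p : (n.+1 < p)%N by rewrite /p -addnn; lia.
have [T1 T01 WT] : exists2 T1, T0 <= T1 & forall t, T1 <= t -> W t = 0.
  pose C : R := (2 * p * n.+1)%:R.
  have C0 : 0 < C by rewrite ltr0n.
  have pR : 0 < p%:R :> R by rewrite ltr0n.
  have a0 : 0 < p%:R^-1 :> R by rewrite invr_gt0.
  have a1 : p%:R^-1 < 1 :> R by rewrite invf_lt1// ltr1n.
  apply: (@finite_time_extinction W E T0 (c / C `^ (1 - p%:R^-1)) p%:R^-1) => //.
  - by rewrite divr_gt0 ?powR_gt0.
  - move=> T; apply: abs_cont_on_lyap => // r rn.
    by apply: abs_cont_onZ; exact: eac.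
  - by move=> t _; apply: lyap_ge0.
  move=> t T0t nEt; have [d [s [dM s1 sn e0 er]]] := ed t T0t nEt.
  exists (dlyap p n k (w t) (w t n) s (d / kap 0%N)).
    apply: (is_derive_lyap (w:=w t)) => // -[_|r rn].
      refine (is_derive_eq (is_deriveZ (kap 1%N)^-1 e0) _).
      rewrite /GRing.scale/= (kapS 0%N)//; field.
      by rewrite !gt_eqF.
    refine (is_derive_eq (is_deriveZ (kap r.+2)^-1 (er r rn)) _).
    rewrite /GRing.scale/= /w srootK spow_root_sigpow XnE /X (kapS r.+1)//; field.
    by rewrite !gt_eqF.
  have D2 : `|d / kap 0%N| <= 1 / 2.
    rewrite normrM normfV (gtr0_norm (kap0 0%N)) ler_pdivrMr//.
    move: kB; rewrite -(big_mkord xpredT k) -/(kap 0%N); lra.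
  have sw : s * w t n = `|w t n| by rewrite /w XnE; apply: sgn_sroot.
  apply: (le_trans (H (w t) s _ s1 sw D2)).
  rewrite !mulNr lerN2 -mulrA; apply: ler_wpM2l; first exact: ltW.
  rewrite mulrC ler_pdivrMr ?powR_gt0//.
  have VC := lyap_le (w t) n1p; rewrite -/C in VC.
  (* From [lyap <= C * wsum ^ p], raising to the power 1 - 1/p compares the decay rate
     [wsum ^ (p - 1)] with [lyap]. *)
  apply: (@le_trans _ _ ((C * wsum n (w t) ^+ p) `^ (1 - p%:R^-1))).
    apply: ge0_ler_powR; rewrite ?nnegrE//; first lra.
    - by apply: lyap_ge0.
    - by rewrite mulr_ge0 ?exprn_ge0 ?wsum_ge0// ltW.
  rewrite powRM ?exprn_ge0 ?wsum_ge0 ?(ltW C0)// mulrC ler_wpM2r ?powR_ge0//.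
  rewrite -powR_mulrn ?wsum_ge0// -powRrM -powR_mulrn ?wsum_ge0//.
  by rewrite mulrBr mulr1 divff ?gt_eqF// -natr1 addrK.
exists T1 => // t r T1t rn.
have := lyap_eq0 n1p (WT t T1t) rn => /sroot_eq0 Xr.
by rewrite XE Xr mulr0.
Qed.
End Chain.

(** * Linear systems with a Hurwitz matrix *)

Section Hurwitz.
Context {R : realType}.
Local Notation mu := (@lebesgue_measure R).
Implicit Types (f g h W : R -> R) (E : set R) (T : R).

Definition vanishes (f : R -> R) := forall eps, 0 < eps -> exists T : R, forall t, T <= t -> `|f t| <= eps.

Lemma linear_decay W h E (a : R) : 0 < a -> mu.-negligible E ->
  (forall T, abs_cont_on W 0 T) -> (forall t, 0 <= W t) -> vanishes h ->
  (forall t, 0 <= t -> ~ E t -> exists2 d, is_derive t 1 W d & d <= - a * W t + h t) ->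
  vanishes W.
Proof.
move=> a0 nE Wac W0 hv Wd eps eps0.
have [T' hT'] := hv (a * (eps / 2)) ltac:(apply: mulr_gt0 => //; lra).
pose T := Num.max 0 T'.
have T0 : 0 <= T by rewrite le_max lexx.
have hT t : T <= t -> h t <= a * (eps / 2).
  by rewrite ge_max => /andP[_ /hT']; apply: le_trans; exact: ler_norm.
(* After this time the lower bound 1 + a (t - T) of the exponential contradicts [W t > eps]. *)
have [T1 T1E] : exists T1, T1 = T + (W T / (eps / 2)) / a by eexists.
have WT : 0 <= W T / (eps / 2) / a by rewrite !divr_ge0// ltW//; lra.
exists T1 => t T1t; rewrite ger0_norm//.
have Tt : T <= t by lra.
(* Integrating factor: beyond [T] the forcing is at most [a * (eps / 2)], so [g] is
   nonincreasing. *)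
pose g s := expR (a * (s - T)) * (W s - eps / 2).
have gle : g t <= g T.
  apply: (abs_cont_on_le Tt _ nE).
    apply: abs_cont_onM; last first.
      by apply: abs_cont_onB; [apply: abs_cont_onW (Wac t)|exact: (abs_cont_on_cst (eps / 2))].
    apply: (@abs_cont_on_comp_in R (fun s => a * (s - T)) expR expR T t 0 (a * (t - T)) (expR (a * (t - T)))).
    - exact: expR_ge0.
    - move=> x _ xt; split; first exact: is_derive_expR.
      by rewrite ger0_norm ?expR_ge0// ler_expR.
    - by move=> s Ts st; split; [apply: mulr_ge0|apply: ler_wpM2l]; lra.
    - by apply: abs_cont_onZ; apply: abs_cont_onB; [exact: abs_cont_on_id|exact: (abs_cont_on_cst T)].
  move=> s Ts st nEs; have [|d Wdd dle] := Wd s _ nEs; first lra.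
  have h0 : is_derive s 1 (fun s => a * (s - T)) (a *: (1 - 0)) :=
    is_deriveZ a (is_deriveB (is_derive_id s 1) (is_derive_cst T s 1)).
  have h1 : is_derive s 1 (fun s => expR (a * (s - T))) _ :=
    is_derive1_comp (f:=expR) (g:=fun s => a * (s - T)) (is_derive_expR _) h0.
  exists (expR (a * (s - T)) *: (d - 0) + (W s - eps / 2) *: (expR (a * (s - T)) * (a *: (1 - 0)))).
    exact: (is_deriveM h1 (is_deriveB Wdd (is_derive_cst (eps / 2) s 1))).
  rewrite /GRing.scale/= !subr0 mulr1 mulrCA -mulrDr pmulr_rle0 ?expR_gt0//.
  have := hT s Ts; rewrite mulrBl; lra.
move: gle; rewrite /g subrr mulr0 expR0 mul1r => gle.
rewrite leNgt; apply/negP => Wt.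
have e1 : 1 + a * (t - T) <= expR (a * (t - T)) by apply: expR_ge1Dx.
have : (1 + a * (t - T)) * (eps / 2) <= W T - eps / 2.
  apply: le_trans gle; apply: ler_pM => //; try lra.
  by rewrite addr_ge0// mulr_ge0//; lra.
have : W T / (eps / 2) <= a * (t - T).
  by rewrite -ler_pdivrMl// mulrC; lra.
by rewrite ler_pdivrMr; lra.
Qed.

Section Linear.
Variables (n : nat) (A : 'M[R]_n) (x : R -> 'cV[R]_n) (E : set R).
Hypothesis nE : mu.-negligible E.
Hypothesis xac : forall j T, abs_cont_on (fun t => x t j 0) 0 T.
Hypothesis xd : forall t, 0 <= t -> ~ E t -> forall j,
  is_derive t 1 (fun t => x t j 0) ((A *m x t) j 0).

Let dot (u : 'rV[R]_n) t := (u *m x t) 0 0.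

Let dot_ac u T : abs_cont_on (dot u) 0 T.
Proof.
have -> : dot u = fun t => \sum_j u 0 j * x t j 0 by apply/funext => t; rewrite /dot mxE.
by apply: abs_cont_on_sum => j; apply: abs_cont_onZ.
Qed.

Let dot_d u t : 0 <= t -> ~ E t -> is_derive t 1 (dot u) (dot (u *m A) t).
Proof.
move=> t0 nEt.
have -> : dot u = \sum_j (u 0 j *: (fun t => x t j 0)).
  by apply/funext => s; rewrite /dot mxE fct_sumE.
have -> : dot (u *m A) t = \sum_j u 0 j *: (A *m x t) j 0.
  by rewrite /dot -mulmxA mxE.
by apply: is_derive_sum => j; apply: is_deriveZ; exact: xd.
Qed.

Let cpx : R -> R[i] := real_complex R.
Let Ac := map_mx cpx A.
Let re (l : 'rV[R[i]]_n) : 'rV[R]_n := map_mx (@complex.Re R) l.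
Let im (l : 'rV[R[i]]_n) : 'rV[R]_n := map_mx (@complex.Im R) l.

Let ReM (z w : R[i]) : complex.Re (z * w) = complex.Re z * complex.Re w - complex.Im z * complex.Im w.
Proof. by case: z w => [? ?] [? ?]. Qed.
Let ImM (z w : R[i]) : complex.Im (z * w) = complex.Re z * complex.Im w + complex.Im z * complex.Re w.
Proof. by case: z w => [? ?] [? ?]. Qed.
Let ReD (z w : R[i]) : complex.Re (z + w) = complex.Re z + complex.Re w.
Proof. by case: z w => [? ?] [? ?]. Qed.
Let ImD (z w : R[i]) : complex.Im (z + w) = complex.Im z + complex.Im w.
Proof. by case: z w => [? ?] [? ?]. Qed.

Let re_mul l lam : re (l *m (Ac - lam%:M)) =
  re l *m A - complex.Re lam *: re l + complex.Im lam *: im l.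
Proof.
apply/rowP => j; rewrite mulmxBr mul_mx_scalar !mxE -mulNr ReD ReM.
have -> : complex.Re (\sum_k l 0 k * Ac k j) = \sum_k re l 0 k * A k j.
  elim/big_rec2: _ => // k u v _ <-; rewrite ReD; congr (_ + _).
  by rewrite ReM !mxE /= mulr0 subr0.
by case: lam => [? ?]/=; ring.
Qed.

Let im_mul l lam : im (l *m (Ac - lam%:M)) =
  im l *m A - complex.Re lam *: im l - complex.Im lam *: re l.
Proof.
apply/rowP => j; rewrite mulmxBr mul_mx_scalar !mxE -mulNr ImD ImM.
have -> : complex.Im (\sum_k l 0 k * Ac k j) = \sum_k im l 0 k * A k j.
  elim/big_rec2: _ => // k u v _ <-; rewrite ImD; congr (_ + _).
  by rewrite ImM !mxE /= mulr0 add0r.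
by case: lam => [? ?]/=; ring.
Qed.

Let nrm2 l t := dot (re l) t ^+ 2 + dot (im l) t ^+ 2.

(* Peeling off the roots of the characteristic polynomial one at a time turns a row
   functional of [x] into a scalar linear equation driven by a vanishing term. *)
Let vanish_foldl s : (forall z, z \in s -> complex.Re z < 0) -> forall l,
  foldl (fun l z => l *m (Ac - z%:M)) l s = 0 -> vanishes (nrm2 l).
Proof.
elim: s => [|lam s IH] sneg l /=.
  move=> -> eps eps0; exists 0 => t _.
  have -> : nrm2 0 t = 0.
    have re0 : re 0 = 0 by apply/rowP => j; rewrite !mxE.
    have im0 : im 0 = 0 by apply/rowP => j; rewrite !mxE.
    by rewrite /nrm2 re0 im0 /dot mul0mx mxE expr0n addr0.
  by rewrite normr0 ltW.
move=> /IH {}IH; pose l' := l *m (Ac - lam%:M).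
have {}IH : vanishes (nrm2 l') by apply: IH => z zs; apply: sneg; rewrite inE zs orbT.
pose a := - complex.Re lam.
have a0 : 0 < a by rewrite oppr_gt0 sneg// mem_head.
apply: (@linear_decay (nrm2 l) (fun t => a^-1 * nrm2 l' t) E a) => //.
- move=> T; apply: abs_cont_onD.
    by under [X in abs_cont_on X]eq_fun do rewrite expr2; apply: abs_cont_onM.
  by under [X in abs_cont_on X]eq_fun do rewrite expr2; apply: abs_cont_onM.
- by move=> t; rewrite addr_ge0 ?sqr_ge0.
- move=> eps eps0; have [T HT] := IH (a * eps) (mulr_gt0 a0 eps0).
  exists T => t /HT; rewrite normrM normfV (gtr0_norm a0) => ?.
  by rewrite mulrC ler_pdivrMr// mulrC.
move=> t t0 nEt.
have d1 := dot_d (re l) t0 nEt; have d2 := dot_d (im l) t0 nEt.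
exists ((2%:R * dot (re l) t ^+ 1) *: dot (re l *m A) t
   + (2%:R * dot (im l) t ^+ 1) *: dot (im l *m A) t).
  exact: (is_deriveD (is_deriveX 2 d1) (is_deriveX 2 d2)).
have dotD u v : dot (u + v) t = dot u t + dot v t by rewrite /dot mulmxDl mxE.
have dotZ c u : dot (c *: u) t = c * dot u t by rewrite /dot -scalemxAl mxE.
have dotN u : dot (- u) t = - dot u t by rewrite /dot mulNmx mxE.
have rE : dot (re l *m A) t = dot (re l') t - a * dot (re l) t - complex.Im lam * dot (im l) t.
  by rewrite /l' re_mul !dotD dotN !dotZ /a; ring.
have iE : dot (im l *m A) t = dot (im l') t - a * dot (im l) t + complex.Im lam * dot (re l) t.
  by rewrite /l' im_mul !dotD !dotN !dotZ /a; ring.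
rewrite rE iE /nrm2 /GRing.scale/= !expr1.
move: (dot (re l) t) (dot (im l) t) (dot (re l') t) (dot (im l') t) => u v u' v'.
(* The couplings through the imaginary part of [lam] cancel in the squared norm. Young's inequality
   splits the forcing, spending half of the decay 2a. *)
have am y z : 2 * y * z <= a * y ^+ 2 + a^-1 * z ^+ 2.
  rewrite -subr_ge0.
  have -> : a * y ^+ 2 + a^-1 * z ^+ 2 - 2 * y * z = a^-1 * (a * y - z) ^+ 2.
    by field; rewrite gt_eqF.
  by rewrite mulr_ge0 ?sqr_ge0// invr_ge0 ltW.
have := am u u'; have := am v v'; rewrite mulrDr; nra.
Qed.

(** By Cayley-Hamilton, peeling off all roots annihilates every row functional, in particular the
    one reading coordinate [j]. *)
Lemma hurwitz_vanishes : hurwitz A -> forall j, vanishes (fun t => x t j 0).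
Proof.
move=> hA j.
(* Cayley-Hamilton is applied in a nontrivial matrix ring; the coordinate [j] witnesses positive
   dimension. *)
have [n' nE'] : exists n', n = n'.+1 by case: (n) j => [[]//|m _]; exists m.
have [s sE] := closed_field_poly_normal (char_poly Ac).
rewrite (monicP (char_poly_monic _)) scale1r in sE.
have sneg z : z \in s -> complex.Re z < 0.
  move=> zs; apply: hA.
  have -> : map_poly (fun x : R => Complex x 0) (char_poly A) = char_poly Ac.
    by rewrite /Ac -(map_char_poly (real_complex R)).
  by rewrite sE root_prod_XsubC.
have ch (l : 'rV[R[i]]_n) : foldl (fun l z => l *m (Ac - z%:M)) l s = 0.
  clear - sE nE'; move: Ac sE l; rewrite nE' => B sE l.
  have F r l0 : foldl (fun l z => l *m (B - z%:M)) l0 r =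
      l0 *m horner_mx B (\prod_(z <- r) ('X - z%:P)).
    elim: r l0 => [|z r IH] l0 /=; first by rewrite big_nil rmorph1 mulmx1.
    by rewrite IH big_cons rmorphM rmorphB/= horner_mx_X horner_mx_C mulmxA.
  by rewrite F -sE Cayley_Hamilton mulmx0.
move=> eps eps0.
have [T HT] := vanish_foldl sneg (ch (delta_mx 0 j)) (exprn_gt0 2 eps0).
exists T => t /HT; rewrite /nrm2.
have -> : dot (re (delta_mx 0 j)) t = x t j 0.
  rewrite /dot mxE (bigD1 j)//= !mxE !eqxx/= mul1r big1 ?addr0// => i ij.
  by rewrite !mxE (negbTE ij) andbF/= mul0r.
have -> : dot (im (delta_mx 0 j)) t = 0.
  by rewrite /dot mxE big1// => i _; rewrite !mxE; case: andP => _ /=; rewrite mul0r.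
rewrite expr0n addr0 ger0_norm ?sqr_ge0// -(real_normK (num_real (x t j 0))).
by rewrite ler_pXn2r// nnegrE ltW.
Qed.
End Linear.
End Hurwitz.

(** * Filippov regularization *)

Section FilippovSets.
Context {R : realType}.

(** Positive dimension matters: the volume of a box in dimension 0 is an empty product, hence 1. *)
Lemma null_set0 N : (0 < N)%N -> @Defs.null_set R N set0.
Proof.
move=> N0 eps eps0; exists (fun=> 0), (fun=> 0); split=> // n.
rewrite big1// => k _; rewrite /vol; apply/eqP; rewrite prodf_seq_eq0.
by apply/hasP; exists (Ordinal N0); rewrite ?mem_index_enum//= subrr.
Qed.

(** A half-space bound valid near [x] survives convex combinations and closure. Differences of two
    coordinates suffice because every error is a plant coordinate minus its estimate. *)
Lemma filippov_le N (F : 'cV[R]_N -> 'cV[R]_N) x v (i1 i2 : 'I_N) b :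
  filippov F x v ->
  (forall e, 0 < e -> \forall y \near x, F y i1 0 - F y i2 0 <= b + e) ->
  v i1 0 - v i2 0 <= b.
Proof.
move=> Fv H; apply/ler_addgt0Pr => e e0.
(* One quarter of [e] goes to the bound near [x] and one to approximating each of the two
   coordinates. *)
have e40 : 0 < e / 4 by rewrite divr_gt0.
have /nbhs_ballP[d /= d0 Hd] := H _ e40.
have N0 : (0 < N)%N by exact: leq_ltn_trans (ltn_ord i1).
have [w [[n [p [u [p0 p1 Fu ->]]]] vw]] := Fv d d0 _ (null_set0 N0) _ e40.
have w12 : (\sum_(k < n) p k *: u k) i1 0 - (\sum_(k < n) p k *: u k) i2 0 <= b + e / 4.
  rewrite !summxE -sumrB -[leRHS]mul1r -[X in X * _]p1 mulr_suml; apply: ler_sum => k _.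
  rewrite !mxE -mulrBr; apply: ler_wpM2l => //.
  have [y [yx _] <-] := Fu k.
  have /Hd : ball x d y by split=> // i j; rewrite (ord1 j) /ball/= distrC; exact: yx.
  by [].
move: w12 (vw i1) (vw i2); move: (\sum_(k < n) _) => S w12.
by rewrite !ltr_norml => /andP[? ?] /andP[? ?]; lra.
Qed.

Lemma filippov_ge N (F : 'cV[R]_N -> 'cV[R]_N) x v (i1 i2 : 'I_N) b :
  filippov F x v ->
  (forall e, 0 < e -> \forall y \near x, b - e <= F y i1 0 - F y i2 0) ->
  b <= v i1 0 - v i2 0.
Proof.
move=> Fv H; rewrite -lerN2 opprB; apply: (filippov_le Fv) => e /H.
by apply: filterS => y; lra.
Qed.

(** Where a coordinate difference of the field is continuous in the state, the Filippov set
    determines it uniquely. *)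
Lemma filippov_near_eq N (F : 'cV[R]_N -> 'cV[R]_N) x v (i1 i2 : 'I_N) (g : 'cV[R]_N -> R) :
  filippov F x v -> (\forall y \near x, F y i1 0 - F y i2 0 = g y) ->
  {for x, continuous g} -> v i1 0 - v i2 0 = g x.
Proof.
move=> Fv FE /cvgrPdist_le cg; apply/eqP; rewrite eq_le; apply/andP; split.
  apply: (filippov_le Fv) => e /cg; apply: filterS2 FE => y ->.
  by rewrite ler_norml => /andP[? ?]; lra.
apply: (filippov_ge Fv) => e /cg; apply: filterS2 FE => y ->.
by rewrite ler_norml => /andP[? ?]; lra.
Qed.

Lemma filippov_eq N (F : 'cV[R]_N -> 'cV[R]_N) x v (i1 i2 : 'I_N) (g : 'cV[R]_N -> R) :
  filippov F x v -> (forall y, F y i1 0 - F y i2 0 = g y) ->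
  {for x, continuous g} -> v i1 0 - v i2 0 = g x.
Proof. by move=> Fv FE; apply: filippov_near_eq Fv _; near=> y; exact: FE.
Unshelve. all: by end_near.
Qed.

(* Near a point with nonzero output the sign is locally constant; at a zero of
   the output the Filippov set only retains the bound. *)
Lemma filippov_sg N (F : 'cV[R]_N -> 'cV[R]_N) x v (i1 i2 : 'I_N)
    (g l : 'cV[R]_N -> R) (c : R) : 0 < c ->
  filippov F x v -> (forall y, F y i1 0 - F y i2 0 = g y - c * Num.sg (l y)) ->
  {for x, continuous g} -> {for x, continuous l} ->
  exists s, [/\ `|s| <= 1, s * l x = `|l x| & v i1 0 - v i2 0 = g x - c * s].
Proof.
(* [s] is the only value compatible with the velocity; the two one-sided Filippov bounds will give
   [|s| <= 1]. *)
move=> c0 Fv FE cg cl; pose s := (g x - (v i1 0 - v i2 0)) / c.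
have vs : v i1 0 - v i2 0 = g x - c * s by rewrite /s; field; rewrite gt_eqF.
have sgb (z : R) : -1 <= Num.sg z <= 1 by rewrite -ler_norml normr_sg; case: (z == 0).
have near_const a : (\forall y \near x, Num.sg (l y) = a) -> s = a.
  move=> la; have : v i1 0 - v i2 0 = g x - c * a.
    apply: (filippov_near_eq (g:=fun y => g y - c * a) Fv).
      by apply: filterS la => y ly; rewrite FE ly.
    exact: (continuousB cg (@cst_continuous _ _ (c * a) x)).
  by rewrite vs => /(congr1 (fun z => (g x - z) / c)); rewrite !subKr !(mulrC c) !mulfK ?gt_eqF.
exists s; split => //.
- have /cvgrPdist_le cgd := cg.
  have sl : v i1 0 - v i2 0 <= g x + c.
    apply: (filippov_le Fv) => e e0; have := cgd _ e0; apply: filterS => y; rewrite FE.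
    rewrite ler_norml => /andP[? ?]; have /andP[s1 s2] := sgb (l y).
    have : c * -1 <= c * Num.sg (l y) by apply: ler_wpM2l => //; exact: ltW.
    lra.
  have sr : g x - c <= v i1 0 - v i2 0.
    apply: (filippov_ge Fv) => e e0; have := cgd _ e0; apply: filterS => y; rewrite FE.
    rewrite ler_norml => /andP[? ?]; have /andP[s1 s2] := sgb (l y).
    have : c * Num.sg (l y) <= c * 1 by apply: ler_wpM2l => //; exact: ltW.
    lra.
  by rewrite ler_norml /s ler_pdivlMr// ler_pdivrMr//; apply/andP; split; lra.
- have [lx|lx|->] := ltgtP (l x) 0; last by rewrite mulr0 normr0.
    rewrite (near_const (-1)) ?mulN1r ?ltr0_norm//.
    near=> y; apply: ltr0_sg; near: y; exact: (cvgr_lt (l x) cl 0 lx).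
  rewrite (near_const 1) ?mul1r ?gtr0_norm//.
  near=> y; apply: gtr0_sg; near: y; exact: (cvgr_gt (l x) cl 0 lx).
Unshelve. all: by end_near.
Qed.

Lemma continuous_sigpow (a : R) : 0 < a -> continuous (fun z : R => sigpow z a).
Proof.
move=> a0 x; rewrite /continuous_at /sigpow gt_eqF//.
have pos z : 0 < z -> {for z, continuous (fun z : R => Num.sg z * `|z| `^ a)}.
  move=> z0; have := ex_derive (is_derive := is_derive1_powR a z0).
  move=> /derivable1_diffP /differentiable_continuous H.
  change ((fun z : R => Num.sg z * `|z| `^ a) @ z --> Num.sg z * `|z| `^ a).
  rewrite [X in _ --> X](_ : _ = z `^ a); last by rewrite gtr0_sg// mul1r gtr0_norm.
  apply: cvg_trans H.
  apply: near_eq_cvg; near=> w; have w0 : 0 < w by near: w; exact: lt_nbhsr.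
  by rewrite gtr0_sg// gtr0_norm// mul1r.
have [x0|x0|->] := ltgtP x 0; last 1 first.
- rewrite sgr0 mul0r; apply/cvgrPdist_lt => e e0; near=> h.
  rewrite sub0r normrN normrM (ger0_norm (powR_ge0 _ _)) normr_sg.
  apply: (@le_lt_trans _ _ (`|h| `^ a)).
    by case: (h == 0); rewrite ?mul1r// mul0r powR_ge0.
  have -> : e = (e `^ a^-1) `^ a by rewrite -powRrM mulVf ?powRr1 ?ltW// gt_eqF.
  apply: gt0_ltr_powR => //; rewrite ?nnegrE ?powR_ge0//.
  near: h; apply/nbhs_ballP; exists (e `^ a^-1) => /=; first exact: powR_gt0.
  by move=> h; rewrite /ball/= sub0r normrN.
- have := pos (- x); rewrite oppr_gt0 => /(_ x0) H.
  have -> : (fun z => Num.sg z * `|z| `^ a) = -%R \o (fun z => Num.sg z * `|z| `^ a) \o -%R.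
    by apply/funext => z /=; rewrite normrN sgrN; ring.
  have -> : Num.sg x * `|x| `^ a = - (Num.sg (- x) * `|- x| `^ a) by rewrite normrN sgrN; ring.
  apply: cvgN; apply: (@cvg_comp _ _ _ -%R (fun z => Num.sg z * `|z| `^ a)) H.
  exact: opp_continuous.
- exact: pos.
Unshelve. all: by end_near.
Qed.
End FilippovSets.

(** * Error dynamics of the observer *)

Section Blocks.
Context {R : realType} (m n : nat) (q : 'I_m -> nat).
Hypothesis qn : (\sum_(i < m) q i)%N = n.
Hypothesis q0 : forall i, (0 < q i)%N.

(** Extends [wst] to the index [m] just past the last block, where it equals [n]. *)
Let psum k := (\sum_(j < m | (j < k)%N) q j)%N.

Let psumS (i : 'I_m) : psum i.+1 = (psum i + q i)%N.
Proof.
rewrite /psum (bigD1 i)//= addnC; congr addn; apply: eq_bigl => j.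
by rewrite ltnS ltn_neqAle andbC.
Qed.

Let psum_le k l : (k <= l)%N -> (psum k <= psum l)%N.
Proof.
move=> kl; rewrite /psum big_mkcond [leqRHS]big_mkcond; apply: leq_sum => j _.
by case: ifP => // jk; rewrite (leq_trans jk).
Qed.

Let psum_m : psum m = n.
Proof. by rewrite -qn; apply: eq_bigl => j; rewrite ltn_ord. Qed.

Let wst_lt (i i' : 'I_m) : (i < i')%N -> (wst q i + q i <= wst q i')%N.
Proof. by move=> ii; rewrite -psumS psum_le. Qed.

Lemma wst_blk_lt i j : (j < q i)%N -> (wst q i + j < n)%N.
Proof.
move=> ji; rewrite -psum_m; apply: leq_trans (psum_le (ltn_ord i)).
by rewrite psumS ltn_add2l.
Qed.

Lemma in_blk_inj i i' r : in_blk q i r -> in_blk q i' r -> i = i'.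
Proof.
move=> /andP[r1 r2] /andP[r3 r4]; apply/val_inj; case: (ltngtP i i') => //= /wst_lt; clear - r1 r2 r3 r4; lia.
Qed.

Lemma in_blk_ex (r : 'I_n) : exists i, in_blk q i r.
Proof.
have ex : exists k, (r < psum k)%N by exists m; rewrite psum_m.
(* The block containing [r] precedes the first partial sum exceeding [r]. *)
case: (ex_minnP ex) => -[|k] rk kmin; first by rewrite /psum big1 in rk.
have km : (k < m)%N.
  rewrite ltnNge; apply/negP => mk; have := kmin m; rewrite psum_m ltn_ord => /(_ isT).
  by rewrite ltnNge mk.
exists (Ordinal km); rewrite /in_blk -psumS rk andbT leqNgt; apply/negP => /kmin.
by rewrite ltnn.
Qed.

(* The [j]-th coordinate of block [i], both counted from 0. *)
Definition bix i j (ji : (j < q i)%N) : 'I_n := Ordinal (wst_blk_lt ji).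

Lemma in_bix i j (ji : (j < q i)%N) : in_blk q i (bix ji).
Proof. by rewrite /in_blk leq_addr ltn_add2l. Qed.

Lemma bix_ex (r : 'I_n) : exists i j (ji : (j < q i)%N), r = bix ji.
Proof.
have [i /andP[r1 r2]] := in_blk_ex r.
have ji : (r - wst q i < q i)%N by lia.
by exists i, (r - wst q i)%N, ji; apply/val_inj => /=; rewrite subnKC.
Qed.

Lemma Jdiag_bix (x : 'cV[R]_n) i j (ji : (j < q i)%N) (jSi : (j.+1 < q i)%N) :
  (Jdiag R q n *m x) (bix ji) 0 = x (bix jSi) 0.
Proof.
rewrite mxE (bigD1 (bix jSi))//= big1 => [|s sj].
  rewrite mxE /= addnS eqxx/= addr0; case: existsP => [_|[]]; first by rewrite mul1r.
  by exists i; rewrite -addnS (in_bix ji) (in_bix jSi).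
rewrite mxE /=; case: eqP => [sE|_]; last by rewrite mul0r.
by case/eqP: sj; apply/val_inj; rewrite /= sE addnS.
Qed.

Lemma Jdiag_bix_last (x : 'cV[R]_n) i j (ji : (j < q i)%N) : j.+1 = q i ->
  (Jdiag R q n *m x) (bix ji) 0 = 0.
Proof.
move=> jq; rewrite mxE big1// => s _; rewrite mxE.
case: eqP => [sE|_]; last by rewrite mul0r.
case: existsP => [[i' /andP[b1 b2]]|_]; last by rewrite mul0r.
have ii := in_blk_inj b1 (in_bix ji); rewrite {i'}ii in b1 b2.
by move: b2; rewrite /in_blk sE /= -jq; lia.
Qed.

Lemma Bdiag_bix (v : 'cV[R]_m) i j (ji : (j < q i)%N) :
  (Bdiag R q n *m v) (bix ji) 0 = if j.+1 == q i then v i 0 else 0.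
Proof.
have key i' : (bix ji : nat) == (wst q i' + q i').-1 -> i' = i /\ j.+1 = q i.
  move=> /eqP bE; have := q0 i' => q'0.
  have b' : in_blk q i' (bix ji) by rewrite /in_blk bE; lia.
  have ii := in_blk_inj b' (in_bix ji); rewrite ii in bE.
  by split=> //; move: bE => /=; have := q0 i; lia.
rewrite mxE; case: eqP => [jq|jq].
  rewrite (bigD1 i)//= big1 => [|i' ii']; rewrite mxE.
    rewrite (_ : _ == _) ?mul1r ?addr0//; apply/eqP => /=; lia.
  case: (boolP (_ == _)) => [/key[iE]|_]; last by rewrite mul0r.
  by rewrite iE eqxx in ii'.
rewrite big1// => i' _; rewrite mxE.
by case: (boolP (_ == _)) => [/key[_ /jq]//|_]; rewrite mul0r.
Qed.

Lemma Cdiag_bix (x : 'cV[R]_n) i : (Cdiag R q n *m x) i 0 = x (bix (q0 i)) 0.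
Proof.
rewrite mxE (bigD1 (bix (q0 i)))//= big1 => [|s sj]; rewrite mxE /=.
  by rewrite addn0 eqxx mul1r addr0.
case: eqP => [sE|_]; last by rewrite mul0r.
by case/eqP: sj; apply/val_inj; rewrite /= sE addn0.
Qed.
End Blocks.

(** * Error equations of the closed loop *)

Section ErrorDynamics.
Context {R : realType} (S : SCB R) (Lb : 'M[R]_(nb S, pb S)) (kap : 'I_(md S) -> nat -> R).
Variables (u0 : R -> 'cV[R]_(m0 S)) (ud : R -> 'cV[R]_(md S)).
Local Notation N := ((na S + nb S + nd S) + (na S + nb S + nd S))%N.
Local Notation F := (closed_loop Lb kap u0 ud).
Implicit Types (y : 'cV[R]_N).

Definition ixa (r : 'I_(na S)) : 'I_N := lshift _ (lshift _ (lshift _ r)).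
Definition iha (r : 'I_(na S)) : 'I_N := rshift _ (lshift _ (lshift _ r)).
Definition ixb (r : 'I_(nb S)) : 'I_N := lshift _ (lshift _ (rshift _ r)).
Definition ihb (r : 'I_(nb S)) : 'I_N := rshift _ (lshift _ (rshift _ r)).
Definition ixd (r : 'I_(nd S)) : 'I_N := lshift _ (rshift _ r).
Definition ihd (r : 'I_(nd S)) : 'I_N := rshift _ (rshift _ r).

Definition ea y := get_xa y - get_ha y.
Definition eb y := get_xb y - get_hb y.
Definition ed y := get_xd y - get_hd y.

Lemma eaE y r : ea y r 0 = y (ixa r) 0 - y (iha r) 0. Proof. by rewrite !mxE. Qed.
Lemma ebE y r : eb y r 0 = y (ixb r) 0 - y (ihb r) 0. Proof. by rewrite !mxE. Qed.
Lemma edE y r : ed y r 0 = y (ixd r) 0 - y (ihd r) 0. Proof. by rewrite !mxE. Qed.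

(** Entrywise rules for sums and opposites only, so that rewriting leaves matrix products folded. *)
Lemma mxaddE m k (A B : 'M[R]_(m, k)) i j : (A + B) i j = A i j + B i j.
Proof. by rewrite mxE. Qed.
Lemma mxoppE m k (A : 'M[R]_(m, k)) i j : (- A) i j = - A i j.
Proof. by rewrite mxE. Qed.

Lemma error_dynamics_a t y r :
  F t y (ixa r) 0 - F t y (iha r) 0 = (Aa S *m ea y) r 0.
Proof.
rewrite /closed_loop /ixa /iha !(col_mxEu, col_mxEd) /ea mulmxBr !(mxaddE, mxoppE).
by ring.
Qed.

Lemma error_dynamics_b t y r :
  F t y (ixb r) 0 - F t y (ihb r) 0 = ((Ab S - Lb *m Cb S) *m eb y) r 0.
Proof.
rewrite /closed_loop /ixb /ihb !(col_mxEu, col_mxEd) /eb mulmxBl !mulmxBr mulmxA.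
by rewrite !(mulmxBr, mxaddE, mxoppE) -!mulmxA; ring.
Qed.

(** The observer copies the terms in [y0] and [Hdd *m yd] from measurements, so they cancel; [Fdd]
    acts on the estimate and leaves the error [ed]. *)
Lemma error_dynamics_d t y r : F t y (ixd r) 0 - F t y (ihd r) 0 =
  (Adstar S *m ed y) r 0
  + (Bd S *m (Fdd S *m ed y + Fda S *m ea y + Fdb S *m eb y + ud t)) r 0
  - ld kap (Cd S *m ed y) r 0.
Proof.
rewrite /closed_loop /ixd /ihd !(col_mxEu, col_mxEd) -mulmxBr -/(ed y).
rewrite /ed /ea /eb /Ad !(mulmxDl, mulmxBr, mulmxDr) !mulmxA !(mxaddE, mxoppE).
by ring.
Qed.

Hypothesis qn : (\sum_(i < md S) @qd R S i)%N = nd S.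
Hypothesis q0 : forall i, (0 < @qd R S i)%N.

(** All that block [i] receives at its last coordinate besides the injection; the other coordinates
    see only their successor and the output. *)
Definition disturbance t y i : R :=
  (Fdd S *m ed y + Fda S *m ea y + Fdb S *m eb y + ud t) i 0.

Lemma ld_bix (v : 'cV[R]_(md S)) i j (ji : (j < @qd R S i)%N) :
  ld kap v (bix qn ji) 0 =
  kap i j * sigpow (v i 0) ((@qd R S i - j.+1)%N%:R / (@qd R S i)%:R).
Proof.
rewrite mxE (bigD1 i)//= big1 => [|i' ii'].
  by rewrite (in_bix qn ji) addKn addr0.
case: ifP => // b; case/eqP: ii'; exact: in_blk_inj b (in_bix qn ji).
Qed.

Lemma error_dynamics_blk t y i j (ji : (j < @qd R S i)%N) (jSi : (j.+1 < @qd R S i)%N) :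
  F t y (ixd (bix qn ji)) 0 - F t y (ihd (bix qn ji)) 0 = ed y (bix qn jSi) 0
  - kap i j * sigpow (ed y (bix qn (q0 i)) 0) ((@qd R S i - j.+1)%N%:R / (@qd R S i)%:R).
Proof.
rewrite error_dynamics_d ld_bix (Cdiag_bix qn) (Jdiag_bix qn (ed y) ji jSi).
by rewrite (Bdiag_bix qn q0) ltn_eqF// addr0.
Qed.

Lemma error_dynamics_last t y i j (ji : (j < @qd R S i)%N) : j.+1 = @qd R S i ->
  F t y (ixd (bix qn ji)) 0 - F t y (ihd (bix qn ji)) 0 =
  disturbance t y i - kap i j * Num.sg (ed y (bix qn (q0 i)) 0).
Proof.
move=> jq; rewrite error_dynamics_d ld_bix (Cdiag_bix qn) (Jdiag_bix_last qn (ed y) ji)//.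
by rewrite (Bdiag_bix qn q0) jq eqxx add0r subnn mul0r /sigpow eqxx.
Qed.

Lemma continuous_ea r : continuous (fun y => ea y r 0).
Proof.
have -> : (fun y => ea y r 0) = fun y => y (ixa r) 0 - y (iha r) 0 by apply/funext => y; rewrite eaE.
by apply: continuous_sub; exact: coord_continuous.
Qed.

Lemma continuous_eb r : continuous (fun y => eb y r 0).
Proof.
have -> : (fun y => eb y r 0) = fun y => y (ixb r) 0 - y (ihb r) 0 by apply/funext => y; rewrite ebE.
by apply: continuous_sub; exact: coord_continuous.
Qed.

Lemma continuous_ed r : continuous (fun y => ed y r 0).
Proof.
have -> : (fun y => ed y r 0) = fun y => y (ixd r) 0 - y (ihd r) 0 by apply/funext => y; rewrite edE.
by apply: continuous_sub; exact: coord_continuous.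
Qed.

Lemma continuous_mulmx (T : topologicalType) m n (M : 'M[R]_(m, n)) (f : T -> 'cV[R]_n) i :
  (forall j, continuous (fun x => f x j 0)) -> continuous (fun x => (M *m f x) i 0).
Proof.
move=> cf.
have -> : (fun x => (M *m f x) i 0) = fun x => \sum_j M i j * f x j 0.
  by apply/funext => x; rewrite mxE.
by apply: continuous_sum => j; apply: continuous_mul => //; exact: (@cst_continuous _ _ (M i j)).
Qed.

(** Time is frozen: the regularization acts on the state alone, so no regularity of [ud] in time
    enters. *)
Lemma continuous_disturbance t i : continuous (fun y => disturbance t y i).
Proof.
rewrite /disturbance.
have -> : (fun y => (Fdd S *m ed y + Fda S *m ea y + Fdb S *m eb y + ud t) i 0)
  = fun y => (Fdd S *m ed y) i 0 + (Fda S *m ea y) i 0 + (Fdb S *m eb y) i 0 + ud t i 0.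
  by apply/funext => y; rewrite !mxaddE.
apply: continuous_add; last exact: (@cst_continuous _ _ (ud t i 0)).
apply: continuous_add; last by apply: continuous_mulmx; exact: continuous_eb.
apply: continuous_add; last by apply: continuous_mulmx; exact: continuous_ea.
by apply: continuous_mulmx; exact: continuous_ed.
Qed.

End ErrorDynamics.

(** * Linear combinations of vanishing functions *)

Section Vanish.
Context {R : realType}.

Lemma vanishesD (f g : R -> R) : vanishes f -> vanishes g -> vanishes (fun t => f t + g t).
Proof.
move=> vf vg eps eps0.
have [T1 H1] := vf (eps / 2) ltac:(lra); have [T2 H2] := vg (eps / 2) ltac:(lra).
exists (Num.max T1 T2) => t; rewrite ge_max => /andP[/H1 ? /H2 ?].
by apply: le_trans (ler_normD _ _) _; lra.
Qed.

Lemma vanishesZ (c : R) (f : R -> R) : vanishes f -> vanishes (fun t => c * f t).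
Proof.
move=> vf eps eps0; have c1 : 0 < `|c| + 1 by have := normr_ge0 c; lra.
have [T HT] := vf (eps / (`|c| + 1)) ltac:(by rewrite divr_gt0).
exists T => t /HT ft; rewrite normrM.
apply: (@le_trans _ _ (`|c| * (eps / (`|c| + 1)))); first by apply: ler_wpM2l.
by rewrite mulrCA ler_piMr ?ltW// ltr_pdivrMr//; lra.
Qed.

Lemma vanishes_mulmx m n (M : 'M[R]_(m, n)) (x : R -> 'cV[R]_n) i :
  (forall j, vanishes (fun t => x t j 0)) -> vanishes (fun t => (M *m x t) i 0).
Proof.
move=> vx.
have -> : (fun t => (M *m x t) i 0) = fun t => \sum_j M i j * x t j 0.
  by apply/funext => t; rewrite mxE.
elim: (index_enum _) => [|j r IH].
  by move=> eps eps0; exists 0 => t _; rewrite big_nil normr0 ltW.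
have -> : (fun t => \sum_(l <- j :: r) M i l * x t l 0) =
    fun t => M i j * x t j 0 + \sum_(l <- r) M i l * x t l 0.
  by apply/funext => t; rewrite big_cons.
by apply: vanishesD IH; exact: vanishesZ.
Qed.
End Vanish.

(** * Block-by-block convergence of the observer *)

Theorem theorem2 (R : realType) (S : SCB R) (Delta : 'I_(md S) -> R)
    (Lb : 'M[R]_(nb S, pb S)) :
  scb_wf S ->
  hurwitz (Aa S) ->
  (forall i, 0 <= Delta i) ->
  hurwitz (Ab S - Lb *m Cb S) ->
  exists kappa : 'I_(md S) -> nat -> R,
    (forall (i : 'I_(md S)) (k : nat), (k < @qd R S i)%N -> 0 < kappa i k) /\
    forall (u0 : R -> 'cV[R]_(m0 S)) (ud : R -> 'cV[R]_(md S))
           (z : R -> 'cV[R]_((na S + nb S + nd S) + (na S + nb S + nd S))),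
      (forall t, 0 <= t -> forall i, `|ud t i 0| <= Delta i) ->
      filippov_solution (closed_loop Lb kappa u0 ud) z ->
      exists Tf : R, forall t, Tf <= t -> get_xd (z t) - get_hd (z t) = 0.
Proof.
move=> [_ qn q0 _ Fdd0] hA D0 hB.
pose n i := (@qd R S i).-1.
have nq i : (n i).+1 = @qd R S i by rewrite /n prednK.
(* The extra 1 is the margin for the vanishing errors of [x_a] and [x_b]. *)
have gains i : exists kap : nat -> R, _ :=
  @differentiator_gains R (n i) (Delta i + 1) (addr_ge0 (D0 i) ler01).
have [kg Hkg] := choice gains.
(* The chain result counts from the innermost coordinate, the observer from the measured one, hence
   the reversal. *)
pose kappa i j := kg i (n i - j)%N.
exists kappa; split=> [i k _|u0 ud z udD [zac zE]]; first by have [kp _] := Hkg i; exact: kp.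
set E := [set t | _] in zE.
pose F := closed_loop Lb kappa u0 ud.
pose v t : 'cV[R]_((na S + nb S + nd S) + (na S + nb S + nd S)) :=
  \col_i (fun s => z s i 0)^`() t.
have zd t : 0 <= t -> ~ E t ->
    (forall i1 i2, is_derive t 1 (fun s => z s i1 0 - z s i2 0) (v t i1 0 - v t i2 0))
    /\ filippov (F t) (z t) (v t).
  move=> t0 nEt; have [zt Ft] : (forall i, derivable (fun s => z s i 0) t 1) /\
      filippov (F t) (z t) (v t) by apply: contrapT => H; apply: nEt.
  have d1 i : is_derive t 1 (fun s => z s i 0) (v t i 0).
    by apply: DeriveDef; [exact: zt|rewrite /v mxE derive1E].
  by split=> // i1 i2; exact: (is_deriveB (d1 i1) (d1 i2)).
have zac2 i1 i2 T : abs_cont_on (fun s => z s i1 0 - z s i2 0) 0 T.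
  (* Absolute continuity is given for nonnegative horizons; a negative [T] is reached by
     restriction. *)
  have T0 : 0 <= Num.max 0 T by rewrite le_max lexx.
  apply: (@abs_cont_onW R _ 0 (Num.max 0 T)) => //; first by rewrite le_max lexx orbT.
  by apply: abs_cont_onB; exact: zac.
have eaf i : (fun t => ea (z t) i 0) = fun t => z t (ixa i) 0 - z t (iha i) 0.
  by apply/funext => t; rewrite eaE.
have van_a j : vanishes (fun t => ea (z t) j 0).
  apply: (@hurwitz_vanishes R _ (Aa S) (fun t => ea (z t)) E zE _ _ hA) => [i T|t t0 nEt i].
    by rewrite eaf.
  have [dz Fz] := zd t t0 nEt; have := dz (ixa i) (iha i).
  rewrite (filippov_eq (g:=fun y => (Aa S *m ea y) i 0) Fz).
  - by rewrite -eaf.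
  - by move=> y; exact: error_dynamics_a.
  - by apply: continuous_mulmx => r; exact: continuous_ea.
have ebf i : (fun t => eb (z t) i 0) = fun t => z t (ixb i) 0 - z t (ihb i) 0.
  by apply/funext => t; rewrite ebE.
have van_b j : vanishes (fun t => eb (z t) j 0).
  apply: (@hurwitz_vanishes R _ (Ab S - Lb *m Cb S) (fun t => eb (z t)) E zE _ _ hB) => [i T|t t0 nEt i].
    by rewrite ebf.
  have [dz Fz] := zd t t0 nEt; have := dz (ixb i) (ihb i).
  rewrite (filippov_eq (g:=fun y => ((Ab S - Lb *m Cb S) *m eb y) i 0) Fz).
  - by rewrite -ebf.
  - by move=> y; exact: error_dynamics_b.
  - by apply: continuous_mulmx => r; exact: continuous_eb.
have step m : exists2 T, 0 <= T & forall (i : 'I_(md S)) j (ji : (j < @qd R S i)%N) t,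
    (i < m)%N -> T <= t -> ed (z t) (bix qn ji) 0 = 0.
  elim: m => [|m [T0 T00 IH]]; first by exists 0.
  have [mlt|mge] := ltnP m (md S); last first.
    exists T0 => // i j ji t im; apply: IH; exact: leq_trans (ltn_ord i) mge.
  pose i0 := Ordinal mlt.
  have [kpos Hk] := Hkg i0.
  have [T1 HT1] := vanishesD (vanishes_mulmx (Fda S) i0 van_a) (vanishes_mulmx (Fdb S) i0 van_b) ltr01.
  pose T2 := Num.max T0 T1.
  have T20 : T0 <= T2 by rewrite le_max lexx.
  have T21 : T1 <= T2 by rewrite le_max lexx orbT.
  have dist t : T2 <= t -> `|disturbance ud t (z t) i0| <= Delta i0 + 1.
    move=> Tt; rewrite /disturbance !mxaddE.
    (* Row [i0] of [Fdd] vanishes on the blocks from [i0] on, and the errors of the earlier blocks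
       are zero by induction. *)
    have -> : (Fdd S *m ed (z t)) i0 0 = 0.
      rewrite mxE big1// => r _; have [j jr] := in_blk_ex qn r.
      have [ji|ij] := ltnP j i0; last by rewrite (Fdd0 i0 j r jr) ?ij ?mul0r.
      have [i' [l [li rE]]] := bix_ex qn r.
      have bi : in_blk (@qd R S) i' r by rewrite rE in_bix.
      have ii := in_blk_inj bi jr.
      by rewrite rE IH ?mulr0 ?ii// (le_trans T20).
    rewrite add0r; apply: le_trans (ler_normD _ _) _; rewrite addrC; apply: lerD.
      by apply: udD; lra.
    by apply: HT1; lra.
  (* Truncated subtraction keeps the reversed index inside the block for every [r], so [e] is
     total. *)
  have ltq r : (n i0 - r < @qd R S i0)%N by rewrite -nq ltnS leq_subr.
  pose e r t := ed (z t) (bix qn (ltq r)) 0.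
  have eE r : e r = fun t => z t (ixd (bix qn (ltq r))) 0 - z t (ihd (bix qn (ltq r))) 0.
    by apply/funext => t; rewrite /e edE.
  have bixE j j' (p : (j < @qd R S i0)%N) (p' : (j' < @qd R S i0)%N) : j = j' -> bix qn p = bix qn p'.
    by move=> jj; apply/val_inj; rewrite /= jj.
  have en t : e (n i0) t = ed (z t) (bix qn (q0 i0)) 0.
    by rewrite /e (bixE _ _ (ltq (n i0)) (q0 i0) (subnn _)).
  have [||T3 T23 HT3] := Hk e E T2 zE.
  - by move=> r T _; rewrite eE; apply: abs_cont_onW (zac2 _ _ T); lra.
  - move=> t T2t nEt; have t0 : 0 <= t by lra.
    have [dz Fz] := zd t t0 nEt.
    (* The last coordinate has exponent 0, so its injection is a sign and the Filippov selection [s]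
       appears here only. *)
    have last y : F t y (ixd (bix qn (ltq 0%N))) 0 - F t y (ihd (bix qn (ltq 0%N))) 0 =
        disturbance ud t y i0 - kg i0 0%N * Num.sg (ed y (bix qn (q0 i0)) 0).
      rewrite error_dynamics_last; first by rewrite /kappa subn0 subnn.
      by rewrite subn0.
    have [s [s1 sl vs]] := filippov_sg (l:=fun y => ed y (bix qn (q0 i0)) 0) (kpos 0%N) Fz last
      (@continuous_disturbance R S ud t i0 (z t)) (@continuous_ed R S _ (z t)).
    exists (disturbance ud t (z t) i0), s; split=> //.
    + exact: dist.
    + by rewrite en.
    + by rewrite eE -vs; exact: dz.
    move=> r rn; rewrite eE.
    have jS : ((n i0 - r.+1).+1 < @qd R S i0)%N by rewrite -nq; lia.
    (* The remaining injections have positive exponents and are continuous, so the velocity is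
       single-valued. *)
    have mid y : F t y (ixd (bix qn (ltq r.+1))) 0 - F t y (ihd (bix qn (ltq r.+1))) 0 =
        ed y (bix qn (ltq r)) 0 - kg i0 r.+1 *
          sigpow (ed y (bix qn (q0 i0)) 0) (r.+1%:R / (n i0).+1%:R).
      rewrite (error_dynamics_blk _ _ _ _ qn q0 t y (ltq r.+1) jS) /kappa nq subKn//.
      rewrite (bixE _ _ jS (ltq r)); last by lia.
      by rewrite (_ : (@qd R S i0 - (n i0 - r.+1).+1)%N = r.+1)// -nq; lia.
    rewrite en /e -(filippov_eq (g:=fun y => ed y (bix qn (ltq r)) 0 - kg i0 r.+1 *
          sigpow (ed y (bix qn (q0 i0)) 0) (r.+1%:R / (n i0).+1%:R)) Fz mid); first exact: dz.
    apply: continuous_sub; first exact: continuous_ed.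
    apply: continuous_mul; first exact: (@cst_continuous _ _ (kg i0 r.+1)).
    move=> y; apply: (@cvg_comp _ _ _ (fun y => ed y (bix qn (q0 i0)) 0)
      (fun x : R => sigpow x (r.+1%:R / (n i0).+1%:R))); first exact: continuous_ed.
    by apply: continuous_sigpow; rewrite divr_gt0.
  exists T3; first lra.
  move=> i j ji t; rewrite ltnS leq_eqVlt => /predU1P[im|im] T3t; last first.
    by apply: IH => //; lra.
  have ii : i = i0 by apply/val_inj.
  rewrite ii in ji *; have jn : (j <= n i0)%N by rewrite -ltnS nq.
  have := HT3 t (n i0 - j)%N T3t (leq_subr _ _); rewrite /e.
  by rewrite (bixE _ _ (ltq (n i0 - j)%N) ji)// subKn.
have [T T0 HT] := step (md S).
exists T => t Tt; apply/matrixP => r c; rewrite (ord1 c) [RHS]mxE.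
have [i [j [ji ->]]] := bix_ex qn r.
exact: HT.
Qed.
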